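(* Consider the edge–three-star model $P_{\beta,h}$ on edge weights of the complete graph $K_n$, and let $X\sim P_{\beta_0,h_0}$. Then for any fixed $\beta_0,h_0\in\mathbb R$, $T_N(X)=o_p(1)$ under $P_{\beta_0,h_0}$ (as $n\to\infty$, $N=\binom n2$).
   Context: Setting. $\kappa_-<\kappa_+$ are real numbers and $\mu$ is a fixed probability measure on $[\kappa_-,\kappa_+]$ with $\kappa_-,\kappa_+\in\mathrm{supp}(\mu)$. Let $N=\binom n2$ and identify $x\in[\kappa_-,\kappa_+]^N$ (indexed by the edges of $K_n$) with a symmetric $n\times n$ matrix $G$ with $G_{ii}=0$, $G_{ij}=G_{ji}=x_{\{i,j\}}$. The edge–three-star model is the probability measure $$\frac{dP_{\beta,h}}{d\mu^{\otimes N}}(G)=\frac1{Z_N(\beta,h)}\exp\Big(\frac{\beta}{3n^2}\sum_{i,j,k,\ell\ \text{distinct}}G_{ij}G_{ik}G_{i\ell}+h\sum_{i<j}G_{ij}\Big),$$ with $Z_N(\beta,h)$ the normalizing constant. Equivalently, the exponent is $\frac\beta3\sum_{e_0,e_1,e_2}A_{e_0e_1e_2}x_{e_0}x_{e_1}x_{e_2}+h\sum_ex_e$, where for edges $e_0,e_1,e_2$ of $K_n$, $A_{e_0e_1e_2}=n^{-2}$ if $e_0,e_1,e_2$ are distinct and share a common vertex (form a three-star), and $A_{e_0e_1e_2}=0$ otherwise. Put $m_e(x)=\sum_{e_1,e_2}A_{ee_1e_2}x_{e_1}x_{e_2}$, $\bar m(x)=\frac1N\sum_em_e(x)$, $T_N(x)=\frac1N\sum_e(m_e(x)-\bar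 m(x))^2$. $T_N(X)=o_p(1)$ means $T_N(X)\to0$ in $P_{\beta_0,h_0}$-probability. *)

(* Defs.v *)
From HB Require Import structures.
From mathcomp Require Import all_boot all_order all_algebra.
From mathcomp Require Import all_classical all_reals all_analysis.
From mathcomp Require Import measurable_realfun.

Set Implicit Arguments.
Unset Strict Implicit.
Unset Printing Implicit Defensive.

Import Order.TTheory GRing.Theory Num.Theory.
Import numFieldNormedType.Exports.

Local Open Scope classical_set_scope.
Local Open Scope ring_scope.

Section cons_pair.
Context d (T : measurableType d) (n : nat).

Definition cons_pair (p : T * n.-tuple T) : n.+1.-tuple T :=
  [tuple of p.1 :: p.2].

Lemma measurable_cons_pair : measurable_fun setT cons_pair.
Proof. exact: measurable_cons. Qed.

HB.instance Definition _ :=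
  isMeasurableFun.Build _ _ _ _ cons_pair measurable_cons_pair.
End cons_pair.

(* The power mu^{(x) n} on n-tuples: mu^{(x) 0} is the point mass at the empty
   tuple, and mu^{(x) n.+1} is the image of mu (x) mu^{(x) n} under consing. *)
Fixpoint product_power d (T : measurableType d) (R : realType)
    (mu : probability T R) (n : nat) : probability (n.-tuple T) R :=
  match n with
  | 0 => @dirac _ (0.-tuple T) [tuple] R
  | n'.+1 =>
      distribution (mu \x product_power mu n')%E (@cons_pair d T n')
  end.

Lemma product_power_box d (T : measurableType d) (R : realType)
    (mu : probability T R) (n : nat) (A : 'I_n -> set T) :
  (forall i, measurable (A i)) ->
  product_power mu n [set x | forall i, A i (tnth x i)] =
  (\prod_(i < n) mu (A i))%E.
Proof.
elim: n A => [|n IH] A mA /=.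
  rewrite big_ord0 diracE (_ : _ \in _) //.
  by rewrite inE/= => -[].
rewrite big_ord_recl -IH; last by move=> i; exact: mA.
have mB : measurable [set x : n.-tuple T | forall i, A (lift ord0 i) (tnth x i)].
  rewrite [X in measurable X](_ : _ =
    \bigcap_(i in [set: 'I_n]) ((@tnth n T)^~ i @^-1` A (lift ord0 i))); last first.
    by apply/seteqP; split => [x H i _|x H i] /=; [exact: H|exact: (H i)].
  apply: fin_bigcap_measurable => //.
  move=> i _; rewrite -[X in measurable X]setTI.
  exact: measurable_tnth.
rewrite -product_measure1E//; congr (product_measure1 _ _ _).
apply/seteqP; split => [[x y] /= H|[x y] /= [H1 H2] i].
  split; first by have := H ord0.
  by move=> i; have := H (lift ord0 i); rewrite tnthS.
by case: (unliftP ord0 i) => [j ->|->//]; rewrite tnthS; exact: H2.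
Qed.

Definition measure_support (R : realType)
    (mu : {measure set (measurableTypeR R) -> \bar R}) : set R :=
  [set x | forall U : set R, open U -> U x -> (0 < mu U)%E].

Definition edge (n : nat) : finType := {e : {set 'I_n} | #|e| == 2}.

Lemma card_edge (n : nat) : #|edge n| = 'C(n, 2).
Proof.
rewrite card_sig -[n in 'C(n, 2)]card_ord -card_draws -sum1_card -sum1_card.
by apply: eq_bigl => e; rewrite !inE.
Qed.

Section edge_three_star.
Context (R : realType) (n : nat).

(* The configuration space R^N indexed by the edges of K_n, via the
   enumeration enum_rank of the finite type of edges. *)
Definition config : Type := #|edge n|.-tuple (measurableTypeR R).

Implicit Types (x : config) (e : edge n) (beta h : R).

Definition weight x e : R := tnth x (enum_rank e).

(* [set i; j] fails to be an edge exactly when i = j, where the entry is 0. *)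
Definition weight_mx x : 'M[R]_n :=
  \matrix_(i, j) oapp (weight x) 0 (insub [set i; j]%SET).

Definition hamiltonian beta h x : R :=
  beta / (3 * n%:R ^+ 2) *
    (\sum_(i < n) \sum_(j < n) \sum_(k < n) \sum_(l < n | uniq [:: i; j; k; l])
       weight_mx x i j * weight_mx x i k * weight_mx x i l)
  + h * \sum_(i < n) \sum_(j < n | (i < j)%N) weight_mx x i j.

Definition partition_function (mu : probability (measurableTypeR R) R)
    beta h : \bar R :=
  (\int[product_power mu #|edge n|]_x (expR (hamiltonian beta h x))%:E)%E.

Definition edge_three_star (mu : probability (measurableTypeR R) R)
    beta h (S : set config) : \bar R :=
  (\int[product_power mu #|edge n|]_(x in S)
     (expR (hamiltonian beta h x) / fine (partition_function mu beta h))%:E)%E.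

Definition three_star (e0 e1 e2 : edge n) : bool :=
  [&& e0 != e1, e0 != e2, e1 != e2 &
   [exists v : 'I_n, [&& v \in val e0, v \in val e1 & v \in val e2]]].

Definition coupling (e0 e1 e2 : edge n) : R :=
  if three_star e0 e1 e2 then n%:R ^- 2 else 0.

Definition local_field x e : R :=
  \sum_(e1 : edge n) \sum_(e2 : edge n)
    coupling e e1 e2 * weight x e1 * weight x e2.

Definition mean_field x : R :=
  'C(n, 2)%:R^-1 * \sum_(e : edge n) local_field x e.

Definition field_variance x : R :=
  'C(n, 2)%:R^-1 * \sum_(e : edge n) (local_field x e - mean_field x) ^+ 2.

End edge_three_star.

Section well_defined.
Context (R : realType) (n : nat).
Implicit Types (mu : probability (measurableTypeR R) R).
Local Notation config := (config R n).

Lemma measurable_weight_mx i j :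
  measurable_fun setT (fun x : config => weight_mx x i j).
Proof.
rewrite (_ : (fun _ => _) =
  fun x : config => oapp (weight x) 0 (insub [set i; j]%SET : option (edge n))).
  case: (insub _) => [e|] /=; last exact: measurable_cst.
  exact: measurable_tnth.
by apply/funext => x; rewrite mxE.
Qed.

Lemma measurable_sum_cond d (T : measurableType d) m (P : pred 'I_m)
    (f : 'I_m -> T -> R) :
  (forall i, measurable_fun setT (f i)) ->
  measurable_fun setT (fun x => \sum_(i < m | P i) f i x).
Proof.
move=> mf; rewrite (_ : (fun _ => _) =
    fun x => \sum_(i < m) if P i then f i x else 0); last first.
  by apply/funext => x; rewrite big_mkcond.
by apply: measurable_sum => i; case: (P i) => //; exact: measurable_cst.
Qed.

Lemma measurable_hamiltonian beta h :
  measurable_fun setT (@hamiltonian R n beta h).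
Proof.
apply: measurable_funD; apply: measurable_funM => //.
  apply: measurable_sum => i; apply: measurable_sum => j.
  apply: measurable_sum => k.
  apply: measurable_sum_cond => l.
  apply: measurable_funM; last exact: measurable_weight_mx.
  by apply: measurable_funM; exact: measurable_weight_mx.
apply: measurable_sum => i; apply: measurable_sum_cond => j.
exact: measurable_weight_mx.
Qed.

Lemma hamiltonian_bounded beta h (a b : R) : exists C : R,
  forall x : config, (forall e, weight x e \in `[a, b]) ->
  hamiltonian beta h x <= C.
Proof.
pose K := Num.max `|a| `|b|.
exists (`|beta / (3 * n%:R ^+ 2)| *
    (\sum_(i < n) \sum_(j < n) \sum_(k < n) \sum_(l < n | uniq [:: i; j; k; l])
       K * K * K)
  + `|h| * \sum_(i < n) \sum_(j < n | (i < j)%N) K) => x H.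
have KG i j : `|weight_mx x i j| <= K.
  rewrite mxE; case: insubP => [e _ _|_] /=; last first.
    by rewrite normr0 le_max normr_ge0.
  have := H e; rewrite in_itv/= => /andP[ae eb].
  have aK : `|a| <= K by rewrite le_max lexx.
  have bK : `|b| <= K by rewrite le_max lexx orbT.
  rewrite ler_norml; apply/andP; split.
    by rewrite (le_trans _ ae)// lerNl (le_trans _ aK)// -normrN ler_norm.
  by rewrite (le_trans eb)// (le_trans _ bK)// ler_norm.
have K0 : 0 <= K by rewrite le_max normr_ge0.
rewrite (le_trans (ler_norm _))// (le_trans (ler_normD _ _))//.
rewrite !normrM lerD// ler_wpM2l//.
  do 4 (rewrite (le_trans (ler_norm_sum _ _ _))//; apply: ler_sum => ? _).
  by rewrite !normrM !ler_pM// mulr_ge0.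
by do 2 (rewrite (le_trans (ler_norm_sum _ _ _))//; apply: ler_sum => ? _).
Qed.


Lemma partition_function_gt0_lty mu (a b : R) beta h :
  mu `[a, b]%classic = 1%E ->
  (0 < partition_function n mu beta h < +oo)%E.
Proof.
move=> mu1; rewrite /partition_function; set P := product_power mu _.
have mE : measurable_fun setT
    (fun x : config => (expR (hamiltonian beta h x))%:E).
  apply/measurable_EFinP; apply: measurableT_comp => //.
  exact: measurable_hamiltonian.
pose B := [set x : config | forall i, (`[a, b]%classic : set R) (tnth x i)].
have PB : P B = 1%E.
  have := @product_power_box _ _ R mu #|edge n| (fun=> `[a, b]%classic)
    (fun=> measurable_itv `[a, b]).
  by rewrite big1.
have mB : measurable B.
  rewrite [X in measurable X](_ : _ = \bigcap_(i in [set: 'I_#|edge n|])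
      ((@tnth _ (measurableTypeR R))^~ i @^-1` `[a, b]%classic)); last first.
    by apply/seteqP; split => [x H i _|x H i] /=; [exact: H|exact: (H i)].
  apply: fin_bigcap_measurable => // i _.
  by rewrite -[X in measurable X]setTI; exact: measurable_tnth.
apply/andP; split.
  rewrite lt_neqAle; apply/andP; split; last first.
    by apply: integral_ge0 => x _; rewrite lee_fin expR_ge0.
  apply/negP => /eqP/esym I0.
  have : (\int[P]_x `|(expR (hamiltonian beta h x))%:E| = 0)%E.
    by rewrite -[RHS]I0; apply: eq_integral => x _; rewrite gee0_abs// lee_fin expR_ge0.
  move=> /ae_eq_integral_abs => /(_ measurableT mE) [N [mN N0 sub]].
  have NT : N = setT.
    apply/seteqP; split => // x _; apply: sub => /= /(_ I) [] /eqP.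
    by rewrite gt_eqF// expR_gt0.
  move: N0; rewrite NT => PT0; have := probability_setT P.
  by rewrite [X in X = _]PT0 => /esym/eqP; rewrite onee_eq0.
have [C HC] := hamiltonian_bounded beta h a b.
have PC : P (~` B) = 0%E by rewrite probability_setC// PB subee.
rewrite (@ge0_negligible_integral _ _ _ _ _ (~` B))//; last exact: measurableC.
rewrite setTD setCK (@le_lt_trans _ _ (\int[P]_(x in B) (cst (expR C)%:E) x)%E)//.
  apply: ge0_le_integral => //=.
  - exact: measurable_funTS.
  - by move=> x Bx; rewrite lee_fin ler_expR HC// => e; have := Bx (enum_rank e).
by rewrite integral_cst// [X in (_ * X)%E]PB mule1 ltry.
Qed.

Lemma edge_three_star_setT mu (a b : R) beta h :
  mu `[a, b]%classic = 1%E -> @edge_three_star R n mu beta h setT = 1%E.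
Proof.
move=> /(partition_function_gt0_lty beta h) /andP[Z0 Zoo].
have Zf : partition_function n mu beta h \is a fin_num.
  by rewrite ge0_fin_numE// ltW.
rewrite /edge_three_star.
under eq_integral do rewrite mulrC EFinM.
rewrite ge0_integralZl//.
- rewrite -/(partition_function n mu beta h) -[X in (_ * X)%E](fineK Zf) -EFinM.
  by rewrite mulVf// gt_eqF// fine_gt0// Z0.
- apply/measurable_EFinP; apply: measurableT_comp => //.
  exact: measurable_hamiltonian.
- by rewrite lee_fin invr_ge0; apply: fine_ge0; exact: ltW.
Qed.

End well_defined.

(* Main.v *)
(* The Hamiltonian depends on the weights, up to O(n), only through the
   normalized degrees d_i: it is (n/2) sum_i phi(d_i) with
   phi(d) = (2 beta / 3) d^3 + h d.  Let L be the logarithmic moment generating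
   function of mu and c(t) = L'(t) the mean of mu tilted by t.  A finite set of
   tilts t_k, chosen so that the c(t_k) form a fine net, attaches to each degree
   d_i a tilt t_i with
     phi(d_i) <= M + t_i d_i - L(t_i) - |d_i - c(t_i)| + small,
     M = max_k (phi(c(t_k)) - t_k c(t_k) + L(t_k)),
   so exp(H) is at most exp(n^2 M / 2) times the product over the edges ij of the
   densities of mu tilted by (t_i + t_j) / 2, times
   exp(- (n/2) sum_i |d_i - c(t_i)| - (1/2) sum_ij gap(t_i, t_j)), where
   gap(s, t) = (L(s) + L(t)) / 2 - L((s + t) / 2).  The gap is minus the logarithm
   of the Bhattacharyya coefficient of the two tilted laws, hence controls
   (c(s) - c(t))^2, and the last factor is exp(- const n^2) as soon as the degrees
   are spread out, which is the case when the field variance exceeds eps.  Only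
   exp(O(n)) tilt vectors occur, each tilted product has total mass one, and by
   Jensen's inequality the partition function is at least exp(n^2 M / 2 - O(n)). *)
Require Import Defs.
From HB Require Import structures.
From mathcomp Require Import all_boot all_order all_algebra.
From mathcomp Require Import all_classical all_reals all_analysis.
From mathcomp Require Import measurable_realfun ring lra.
Import Order.TTheory GRing.Theory Num.Theory.
Import numFieldNormedType.Exports.
Local Open Scope classical_set_scope.
Local Open Scope ring_scope.

Set Implicit Arguments.
Unset Strict Implicit.
Unset Printing Implicit Defensive.

(** * Integrals of products over product measures *)

Lemma integral_prod_meas_mul d1 d2 (T1 : measurableType d1)
    (T2 : measurableType d2) (R : realType) (m1 : probability T1 R)
    (m2 : probability T2 R) (f : T1 -> R) (g : T2 -> R) :
  m1.-integrable setT (EFin \o f) -> m2.-integrable setT (EFin \o g) ->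
  (m1 \x m2)%E.-integrable setT (fun z => (f z.1 * g z.2)%:E) /\
  (\int[m1 \x m2]_z (f z.1 * g z.2)%:E = (\int[m1]_x f x)%:E * (\int[m2]_y g y)%:E)%E.
Proof.
move=> intf intg.
have mf : measurable_fun setT f by apply/measurable_EFinP; exact: measurable_int intf.
have mg : measurable_fun setT g by apply/measurable_EFinP; exact: measurable_int intg.
have mfg : measurable_fun setT (fun z : T1 * T2 => (f z.1 * g z.2)%:E).
  apply/measurable_EFinP; apply: measurable_funM.
    exact: measurableT_comp mf measurable_fst.
  exact: measurableT_comp mg measurable_snd.
have intfg : (m1 \x m2)%E.-integrable setT (fun z => (f z.1 * g z.2)%:E).
  (* Tonelli: the iterated integral of [|f| * |g|] factors into two finite integrals; Fubini then
     gives the value. *)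
  apply/integrable12ltyP => //.
  under eq_integral => x _.
    under eq_integral do rewrite /= normrM EFinM.
    rewrite ge0_integralZl//; last first.
      by apply/measurable_EFinP; exact: measurableT_comp.
    over.
  rewrite ge0_integralZr//; first last.
  - exact: integral_ge0.
  - by apply/measurable_EFinP; exact: measurableT_comp.
  apply: lte_mul_pinfty; [exact: integral_ge0| idtac | by have /integrableP[_] := intg].
  rewrite ge0_fin_numE; last exact: integral_ge0.
  by have /integrableP[_] := intf.
split => //.
rewrite -integral12_prod_meas1// /fubini_F /=.
under eq_integral => x _.
  under eq_integral do rewrite EFinM.
  rewrite integralZl//; over.
rewrite -[X in (_ * X)%E]/(\int[m2]_y g y)%:E.
rewrite !fineK ?integrable_fin_num//.
under eq_integral => x _ do rewrite -(fineK (integrable_fin_num measurableT intg)).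
by rewrite integralZr// fineK// integrable_fin_num.
Qed.

(** Independence of the coordinates. In the induction, a change of variables along [cons_pair] turns
    the integral over [n.+1]-tuples into one against [mu \x product_power mu n], where the integrand
    splits into head and tail. *)
Lemma product_power_prod d (T : measurableType d) (R : realType)
    (mu : probability T R) (n : nat) (f : 'I_n -> T -> R) :
  (forall i, mu.-integrable setT (EFin \o f i)) ->
  (product_power mu n).-integrable setT
    (EFin \o (fun x => \prod_i f i (tnth x i))) /\
  \int[product_power mu n]_x (\prod_i f i (tnth x i)) =
    \prod_i \int[mu]_x f i x.
Proof.
elim: n f => [|n IH] f intf.
  rewrite (_ : (fun _ => _) = cst 1); last first.
    by apply/funext => x; rewrite big_ord0.
  rewrite big_ord0; split; first exact: finite_measure_integrable_cst.
  rewrite Rintegral_cst// mul1r [X in fine X](_ : _ = 1%E)//.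
  exact: probability_setT.
have [intg Eg] := IH (fun i => f (lift ord0 i)) (fun i => intf _).
pose g := fun x : n.-tuple T => \prod_i f (lift ord0 i) (tnth x i).
have [inth Eh] := integral_prod_meas_mul (intf ord0) intg.
pose F := fun x : n.+1.-tuple T => (\prod_i f i (tnth x i))%:E.
have FE : (F \o @cons_pair _ T n) = fun z => (f ord0 z.1 * g z.2)%:E.
  apply/funext => -[x y] /=; rewrite /F /g big_ord_recl; congr (_ * _)%:E.
  by apply: eq_bigr => i _; rewrite tnthS.
have mF : measurable_fun setT F.
  apply/measurable_EFinP; apply: measurable_prod => i _.
  apply: (measurableT_comp (f := f i)); last exact: measurable_tnth.
  by apply/measurable_EFinP; exact: measurable_int (intf i).
have mc : measurable_fun setT (@cons_pair _ T n) by exact: measurable_cons_pair.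
split.
  apply: (integrable_pushforward mc mF) => //.
  by rewrite preimage_setT FE.
rewrite /Rintegral /= -/F.
rewrite (_ : (\int[_]_x _)%E = (\int[pushforward
  (mu \x product_power mu n)%E (@cons_pair _ T n)]_x F x)%E)//.
rewrite (integral_pushforward mc mF)//; last by rewrite preimage_setT FE.
by rewrite preimage_setT FE Eh /= big_ord_recl -Eg.
Qed.

(** * Probabilities carried by a set *)

Section probability_one.
Context d (T : measurableType d) (R : realType) (P : probability T R).
Context (A : set T) (mA : measurable A) (PA : P A = 1%E).

Let PAc : P (~` A) = 0%E.
Proof. by rewrite probability_setC// PA subee. Qed.

Lemma bounded_integrable (f : T -> R) (M : R) :
  measurable_fun setT f -> (forall x, A x -> `|f x| <= M) ->
  P.-integrable setT (EFin \o f).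
Proof.
move=> mf fM; apply/(negligible_integrable (N := ~` A)) => //.
- exact: measurableC.
- exact/measurable_EFinP.
rewrite setTD setCK; apply: measurable_bounded_integrable => //.
- exact: le_lt_trans (probability_le1 P mA) (ltry _).
- exact: measurable_funTS.
- exists M; split; first exact: num_real.
  by move=> y My x Ax; rewrite /= (le_trans (fM _ Ax))// ltW.
Qed.

Lemma integrable_EFinZl (a : R) (f : T -> R) :
  P.-integrable setT (EFin \o f) -> P.-integrable setT (EFin \o (fun x => a * f x)).
Proof. exact: integrableZl. Qed.

Lemma integrable_EFinD (f g : T -> R) :
  P.-integrable setT (EFin \o f) -> P.-integrable setT (EFin \o g) ->
  P.-integrable setT (EFin \o (fun x => f x + g x)).
Proof. exact: integrableD. Qed.

Lemma integrable_EFinB (f g : T -> R) :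
  P.-integrable setT (EFin \o f) -> P.-integrable setT (EFin \o g) ->
  P.-integrable setT (EFin \o (fun x => f x - g x)).
Proof. exact: integrableB. Qed.

Lemma integrable_EFin_sum (I : Type) (s : seq I) (Q : pred I) (f : I -> T -> R) :
  (forall i, P.-integrable setT (EFin \o f i)) ->
  P.-integrable setT (EFin \o (fun x => \sum_(i <- s | Q i) f i x)).
Proof.
move=> intf.
rewrite (_ : EFin \o _ = fun x => (\sum_(i <- s | Q i) (EFin \o f i) x)%E).
  exact: integrable_sum.
by apply/funext => x; rewrite /= sumEFin.
Qed.

Lemma Rintegral_sum (I : Type) (s : seq I) (Q : pred I) (f : I -> T -> R) :
  (forall i, P.-integrable setT (EFin \o f i)) ->
  \int[P]_x (\sum_(i <- s | Q i) f i x) = \sum_(i <- s | Q i) \int[P]_x f i x.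
Proof.
move=> intf; elim: s => [|i s IH].
  by under eq_Rintegral do rewrite big_nil; rewrite big_nil Rintegral_cst// mul0r.
rewrite big_cons -IH; case: ifPn => Qi; last first.
  by apply: eq_Rintegral => x _; rewrite big_cons (negbTE Qi).
rewrite -RintegralD//; last exact: integrable_EFin_sum.
by apply: eq_Rintegral => x _; rewrite big_cons Qi.
Qed.

(** The complement of [A] is negligible, so both integrals may be restricted to [A]. This is what
    lets every later estimate assume weights bounded by [B]. *)
Lemma le_Rintegral_on (f g : T -> R) :
  P.-integrable setT (EFin \o f) -> P.-integrable setT (EFin \o g) ->
  (forall x, A x -> f x <= g x) -> \int[P]_x f x <= \int[P]_x g x.
Proof.
move=> intf intg fg.
have E h : P.-integrable setT (EFin \o h) -> \int[P]_x h x = \int[P]_(x in A) h x.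
  move=> inth; rewrite /Rintegral (negligible_integral (N := ~` A))//.
    by rewrite setTD setCK.
  exact: measurableC.
rewrite !E//; apply: le_Rintegral => //; exact: integrableS (subsetT _) _.
Qed.

End probability_one.

(** * Exponential tilting *)

(* [average], [log_mgf] and [tilt] are locked because unification otherwise
   unfolds them down to the construction of the integral. *)
HB.lock Definition average (R : realType)
  (mu : probability (measurableTypeR R) R) (f : R -> R) : R := \int[mu]_x f x.

HB.lock Definition log_mgf (R : realType)
  (mu : probability (measurableTypeR R) R) (t : R) : R :=
  ln (average mu (fun x => expR (t * x))).

HB.lock Definition tilt (R : realType)
  (mu : probability (measurableTypeR R) R) (t x : R) : R :=
  expR (t * x - log_mgf mu t).

Section tilting.
Context (R : realType) (mu : probability (measurableTypeR R) R).
Local Notation average := (average mu).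
Local Notation log_mgf := (log_mgf mu).
Local Notation tilt := (tilt mu).

Definition averageable (f : R -> R) : Prop :=
  mu.-integrable setT (EFin \o f).

Definition tilted_mean (t : R) : R := average (fun x => x * tilt t x).

Definition log_mgf_gap (s t : R) : R :=
  (log_mgf s + log_mgf t) / 2 - log_mgf ((s + t) / 2).

Lemma tiltE t x : tilt t x = expR (t * x - log_mgf t).
Proof. by rewrite tilt.unlock. Qed.

Lemma averageableZ a f : averageable f -> averageable (fun x => a * f x).
Proof. exact: integrable_EFinZl. Qed.

Lemma averageableD f g :
  averageable f -> averageable g -> averageable (fun x => f x + g x).
Proof. exact: integrable_EFinD. Qed.

Lemma averageableB f g :
  averageable f -> averageable g -> averageable (fun x => f x - g x).
Proof. exact: integrable_EFinB. Qed.

Lemma averageZ a f : averageable f -> average (fun x => a * f x) = a * average f.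
Proof. by rewrite average.unlock; exact: RintegralZl. Qed.

Lemma averageD f g : averageable f -> averageable g ->
  average (fun x => f x + g x) = average f + average g.
Proof. by rewrite average.unlock; exact: RintegralD. Qed.

Lemma averageB f g : averageable f -> averageable g ->
  average (fun x => f x - g x) = average f - average g.
Proof. by rewrite average.unlock; exact: RintegralB. Qed.

Lemma averageable_cst a : averageable (fun=> a).
Proof. exact: finite_measure_integrable_cst. Qed.

Lemma average_cst a : average (fun=> a) = a.
Proof.
rewrite average.unlock Rintegral_cst// [X in fine X](_ : _ = 1%E) ?mulr1//.
exact: probability_setT.
Qed.

Context (B : R) (B0 : 0 <= B) (muB : mu `[- B, B]%classic = 1%E).

Let mI : measurable (`[- B, B]%classic : set (measurableTypeR R)).
Proof. exact: measurable_itv. Qed.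

Let itvB x : `[- B, B]%classic x -> `|x| <= B.
Proof. by rewrite /= in_itv /= ler_norml. Qed.

Lemma averageable_bounded (f : R -> R) M : measurable_fun setT f ->
  (forall x, `|x| <= B -> `|f x| <= M) -> averageable f.
Proof.
move=> mf fM; apply: (bounded_integrable mI muB (M := M)) => // x /itvB.
exact: fM.
Qed.

Lemma le_average f g : averageable f -> averageable g ->
  (forall x, `|x| <= B -> f x <= g x) -> average f <= average g.
Proof.
by rewrite average.unlock => intf intg fg; apply: (le_Rintegral_on mI muB) => // x /itvB; exact: fg.
Qed.

Lemma averageable_expR t : averageable (fun x => expR (t * x)).
Proof.
apply: (averageable_bounded (M := expR (`|t| * B))).
  by apply: measurableT_comp => //; exact: measurable_funM.
move=> x xB; rewrite ger0_norm ?expR_ge0// ler_expR.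
by rewrite (le_trans (ler_norm _))// normrM ler_wpM2l.
Qed.

Lemma mgf_gt0 t : 0 < average (fun x => expR (t * x)).
Proof.
apply: (@lt_le_trans _ _ (average (fun=> expR (- (`|t| * B))))).
  by rewrite average_cst expR_gt0.
apply: le_average; [exact: averageable_cst|exact: averageable_expR|].
move=> x xB; rewrite ler_expR lerNl (le_trans (ler_norm _))//.
by rewrite normrN normrM ler_wpM2l.
Qed.

Lemma expR_log_mgf t : expR (log_mgf t) = average (fun x => expR (t * x)).
Proof. by rewrite log_mgf.unlock lnK// posrE mgf_gt0. Qed.

Lemma tilt_expRM t x : tilt t x = expR (- log_mgf t) * expR (t * x).
Proof. by rewrite tilt.unlock addrC expRD. Qed.

Lemma tilt_ge0 t x : 0 <= tilt t x.
Proof. by rewrite tilt.unlock expR_ge0. Qed.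

Lemma averageable_tilt t : averageable (tilt t).
Proof.
rewrite (_ : tilt t = fun x => expR (- log_mgf t) * expR (t * x)).
  by apply: averageableZ; exact: averageable_expR.
by apply/funext => x; rewrite tilt_expRM.
Qed.

Lemma average_tilt t : average (tilt t) = 1.
Proof.
rewrite (_ : tilt t = fun x => expR (- log_mgf t) * expR (t * x)).
  rewrite averageZ; last exact: averageable_expR.
  by rewrite expRN expR_log_mgf mulVf// gt_eqF// mgf_gt0.
by apply/funext => x; rewrite tilt_expRM.
Qed.

Lemma averageable_id_tilt t : averageable (fun x => x * tilt t x).
Proof.
apply: (averageable_bounded (M := B * expR (`|t| * B - log_mgf t))).
  apply: measurable_funM => //; rewrite tilt.unlock; apply: measurableT_comp => //.
  by apply: measurable_funB => //; exact: measurable_funM.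
move=> x xB; rewrite normrM ler_pM// ger0_norm ?tilt_ge0// tiltE ler_expR lerD2r.
by rewrite (le_trans (ler_norm _))// normrM ler_wpM2l.
Qed.

Lemma tilted_mean_bounded t : `|tilted_mean t| <= B.
Proof.
have E (a : R) : a = average (fun x => a * tilt t x).
  by rewrite averageZ; [rewrite average_tilt mulr1|exact: averageable_tilt].
have intE (a : R) : averageable (fun x => a * tilt t x).
  by apply: averageableZ; exact: averageable_tilt.
rewrite ler_norml; apply/andP; split.
  rewrite [leLHS]E; apply: le_average; [exact: intE|exact: averageable_id_tilt|].
  by move=> x; rewrite ler_norml => /andP[? _]; rewrite ler_wpM2r ?tilt_ge0.
rewrite [leRHS]E; apply: le_average; [exact: averageable_id_tilt|exact: intE|].
by move=> x; rewrite ler_norml => /andP[_ ?]; rewrite ler_wpM2r ?tilt_ge0.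
Qed.

(** For [|x| <= B], changing the tilt from [t] to [s] multiplies [expR (t * x)] by at most
    [expR (B * |s - t|)]. *)
Lemma log_mgf_lipschitz s t : log_mgf s <= log_mgf t + B * `|s - t|.
Proof.
rewrite -ler_expR expRD !expR_log_mgf mulrC -averageZ; last first.
  exact: averageable_expR.
apply: le_average; [exact: averageable_expR| |].
  by apply: averageableZ; exact: averageable_expR.
move=> x xB; rewrite -expRD ler_expR -lerBlDr -mulrBl.
by rewrite (le_trans (ler_norm _))// normrM mulrC ler_wpM2r.
Qed.

Lemma log_mgf0 : log_mgf 0 = 0.
Proof.
rewrite log_mgf.unlock (_ : (fun _ => _) = fun=> 1).
  by rewrite average_cst ln1.
by apply/funext => x; rewrite mul0r expR0.
Qed.

Lemma log_mgf_bounded t : `|log_mgf t| <= B * `|t|.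
Proof.
have := log_mgf_lipschitz t 0; have := log_mgf_lipschitz 0 t.
rewrite log_mgf0 !add0r subr0 normrN ler_norml.
by move: (log_mgf t) (B * `|t|) => a b h1 h2; lra.
Qed.

(** Both endpoints lie at distance [|s - t| / 2] from the midpoint, so the Lipschitz bound applies
    to each half of the gap. *)
Lemma log_mgf_gap_le s t : log_mgf_gap s t <= B * `|s - t| / 2.
Proof.
have := log_mgf_lipschitz s ((s + t) / 2).
have := log_mgf_lipschitz t ((s + t) / 2).
have -> : t - (s + t) / 2 = - ((s - t) / 2) by field.
have -> : s - (s + t) / 2 = (s - t) / 2 by field.
rewrite normrN normrM (ger0_norm (_ : 0 <= 2^-1 :> R)) ?invr_ge0// /log_mgf_gap.
by move: (log_mgf _) (log_mgf _) (log_mgf _) `|_| => a b c m; lra.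
Qed.

Lemma tilt_geometric_mean s t x :
  expR ((s * x - log_mgf s) / 2) * expR ((t * x - log_mgf t) / 2) =
  expR (- log_mgf_gap s t) * tilt ((s + t) / 2) x.
Proof.
rewrite tiltE -!expRD /log_mgf_gap; congr expR.
by move: (log_mgf _) (log_mgf _) (log_mgf _) => a b c; field.
Qed.

Let sqr_expR_half (a : R) : expR (a / 2) ^+ 2 = expR a.
Proof. by rewrite expr2 -expRD -splitr. Qed.

(** Convexity of [log_mgf] through AM-GM: the geometric mean of the two tilted densities has
    integral [expR (- log_mgf_gap s t)] and lies below their arithmetic mean, of integral 1. *)
Lemma log_mgf_gap_ge0 s t : 0 <= log_mgf_gap s t.
Proof.
rewrite -oppr_le0 -expR_le1.
have intst : averageable (fun x => tilt s x + tilt t x).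
  by apply: averageableD; exact: averageable_tilt.
have E : average (fun x => 2^-1 * (tilt s x + tilt t x)) = 1.
  rewrite averageZ// averageD; [|exact: averageable_tilt..].
  by rewrite !average_tilt; lra.
have := averageZ (expR (- log_mgf_gap s t)) (averageable_tilt ((s + t) / 2)).
rewrite average_tilt mulr1 => <-; rewrite -[leRHS]E.
apply: le_average.
- by apply: averageableZ; exact: averageable_tilt.
- exact: averageableZ.
move=> x _; rewrite -tilt_geometric_mean !tiltE.
rewrite -(sqr_expR_half (s * x - _)) -(sqr_expR_half (t * x - _)).
move: (expR ((s * x - log_mgf s) / 2)) (expR ((t * x - log_mgf t) / 2)) => p q.
by have := sqr_ge0 (p - q); rewrite sqrrB; lra.
Qed.

(* By [tilt_geometric_mean], [expR (- gap)] is the Bhattacharyya coefficient of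
   the two tilted laws; this is |E_s - E_t| <= 2 B * (Hellinger distance), in the
   form of Young's inequality with parameter [l]. *)
Lemma tilted_mean_gap_young s t l : 0 < l ->
  tilted_mean s - tilted_mean t <= B * (log_mgf_gap s t / l + 2 * l).
Proof.
move=> l0; have ln0 : l != 0 by rewrite gt_eqF.
set m := (s + t) / 2; set g := log_mgf_gap s t.
have intZ a r : averageable (fun x => a * tilt r x).
  by apply: averageableZ; exact: averageable_tilt.
have avgZ a r : average (fun x => a * tilt r x) = a.
  by rewrite averageZ; [rewrite average_tilt mulr1|exact: averageable_tilt].
rewrite /tilted_mean -averageB; [|exact: averageable_id_tilt..].
(* With [p], [q] the square roots of the two densities, Young's inequality bounds [x * (p^2 - q^2)]
   by [B * ((p - q)^2 / l + l * (p + q)^2) / 2]. Expanding gives the coefficient [a] for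
   [p^2 + q^2], and [b] for the midpoint density that replaces the product [p * q]. *)
pose a := B * ((l^-1 + l) / 2); pose b := B * ((l^-1 - l) * expR (- g)).
have intaa : averageable (fun x => a * tilt s x + a * tilt t x).
  exact: averageableD.
apply: (@le_trans _ _
    (average (fun x => (a * tilt s x + a * tilt t x) - b * tilt m x))).
  apply: le_average; [|exact: averageableB|].
    by apply: averageableB; exact: averageable_id_tilt.
  move=> x xB.
  have -> : b * tilt m x = B * ((l^-1 - l) * (expR (- g) * tilt m x)).
    by rewrite /b !mulrA.
  rewrite -tilt_geometric_mean !tiltE.
  rewrite -(sqr_expR_half (s * x - _)) -(sqr_expR_half (t * x - _)).
  have := expR_ge0 ((s * x - log_mgf s) / 2).
  have := expR_ge0 ((t * x - log_mgf t) / 2).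
  move: (expR ((s * x - log_mgf s) / 2)) (expR ((t * x - log_mgf t) / 2)).
  move=> p q q0 p0.
  have -> : x * p ^+ 2 - x * q ^+ 2 = x * ((p - q) * (p + q)) by ring.
  apply: (@le_trans _ _ (B * `|(p - q) * (p + q)|)).
    by rewrite (le_trans (ler_norm _))// normrM ler_wpM2r.
  have -> : a * p ^+ 2 + a * q ^+ 2 - B * ((l^-1 - l) * (p * q)) =
      B * ((l^-1 * (p - q) ^+ 2 + l * (p + q) ^+ 2) / 2).
    by rewrite /a; field.
  rewrite ler_wpM2l// normrM.
  rewrite -(real_normK (num_real (p - q))) -(real_normK (num_real (p + q))).
  move: `|p - q| `|p + q| => u v.
  have -> : (l^-1 * u ^+ 2 + l * v ^+ 2) / 2 = u * v + (u - l * v) ^+ 2 / (2 * l).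
    by field.
  by rewrite lerDl divr_ge0 ?sqr_ge0// mulr_ge0// ltW.
rewrite averageB// averageD// !avgZ /a /b.
have := log_mgf_gap_ge0 s t; rewrite -/g -oppr_le0 -expR_le1 => A2.
have := expR_ge1Dx (- g) => A1.
move: (expR _) A1 A2 => A A1 A2.
(* Here [1 - g <= A <= 1]: the lower bound controls [(1 - A) / l], the upper one [l * (1 + A)]. *)
have -> : B * ((l^-1 + l) / 2) + B * ((l^-1 + l) / 2) - B * ((l^-1 - l) * A) =
    B * ((1 - A) / l + l * (1 + A)) by field.
rewrite ler_wpM2l// lerD//.
  by rewrite ler_pM2r ?invr_gt0//; lra.
by rewrite mulrC ler_pM2r//; lra.
Qed.

(** Young's bound with a parameter proportional to the difference of the means; both sides are
    symmetric in [s] and [t], so a positive difference may be assumed. *)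
Lemma sqr_tilted_mean_gap s t :
  (tilted_mean s - tilted_mean t) ^+ 2 <= 8 * B ^+ 2 * log_mgf_gap s t.
Proof.
have H a b : 0 < tilted_mean a - tilted_mean b ->
    (tilted_mean a - tilted_mean b) ^+ 2 <= 8 * B ^+ 2 * log_mgf_gap a b.
  have := @tilted_mean_gap_young a b.
  move: (_ - _) (log_mgf_gap a b) => y g Y y0.
  have [B_eq0|Bn0] := eqVneq B 0.
    have := Y _ ltr01; rewrite B_eq0 mul0r => y_le0.
    by move: y0; rewrite ltNge y_le0.
  have Bp : 0 < B by rewrite lt_neqAle eq_sym Bn0.
  (* With [l = y / (4 * B)] the term [B * (2 * l)] equals [y / 2] and is absorbed on the left. *)
  have l0 : 0 < y / (4 * B) by rewrite divr_gt0// mulr_gt0.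
  have := Y _ l0.
  have -> : B * (g / (y / (4 * B)) + 2 * (y / (4 * B))) =
    (4 * B ^+ 2 * g) / y + y / 2 by field; rewrite Bn0 gt_eqF.
  rewrite -lerBlDr ler_pdivlMr// => h.
  by rewrite expr2; move: h; lra.
have gapC : log_mgf_gap t s = log_mgf_gap s t.
  by rewrite /log_mgf_gap (addrC t) (addrC (log_mgf t)).
have [ts|st|->] := ltgtP (tilted_mean t) (tilted_mean s).
- by apply: H; rewrite subr_gt0.
- by rewrite -sqrrN opprB -gapC; apply: H; rewrite subr_gt0.
- rewrite subrr expr0n/=; apply: mulr_ge0; last exact: log_mgf_gap_ge0.
  by rewrite mulr_ge0// sqr_ge0.
Qed.

End tilting.

(** * Degrees and local fields *)

(** Every edge at [i] is [[set i; j]] for exactly one [j]; for [j = i] the set is a singleton,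
    [insub] fails and the term is 0. *)
Lemma sum_star (V : nmodType) (n : nat) (F : edge n -> V) (i : 'I_n) :
  \sum_j oapp F 0 (insub [set i; j]%SET) = \sum_(e : edge n | i \in val e) F e.
Proof.
transitivity (\sum_j \sum_(e : edge n | val e == [set i; j]%SET) F e).
  apply: eq_bigr => j _; case: insubP => [e _ <-|/= N].
    by rewrite (big_pred1 e).
  by rewrite big_pred0// => e; apply: contraNF N => /eqP <-; exact: valP e.
rewrite (exchange_big_dep (fun e : edge n => i \in val e)) /=; last first.
  by move=> j e _ /eqP ->; rewrite !inE eqxx.
apply: eq_bigr => e ie.
have [b ib eib] : exists2 b, i != b & val e = [set i; b]%SET.
  have /cards2P[a [b [ab eab]]] := valP e.
  have : i \in [set a; b]%SET by rewrite -eab.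
  rewrite eab !inE => /orP[] /eqP ->; first by exists b.
  by exists a; [rewrite eq_sym|rewrite finset.setUC].
rewrite (big_pred1 b)// => j; rewrite eib /=; apply/eqP/eqP => [E|-> //].
have : b \in [set i; j]%SET by rewrite -E !inE eqxx orbT.
by rewrite !inE (eq_sym b i) (negbTE ib) => /eqP.
Qed.

Lemma sum_edge_incidence (V : nmodType) (n : nat) (F : edge n -> 'I_n -> V) :
  \sum_i \sum_(e : edge n | i \in val e) F e i =
  \sum_(e : edge n) \sum_(i in val e) F e i.
Proof. by rewrite (exchange_big_dep predT). Qed.

Lemma sum_pairs_edges (V : nmodType) (n : nat) (F : edge n -> V) :
  \sum_i \sum_j oapp F 0 (insub [set i; j]%SET) = (\sum_(e : edge n) F e) *+ 2.
Proof.
under eq_bigr do rewrite sum_star.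
rewrite (sum_edge_incidence (fun e _ => F e)) -sumrMnl; apply: eq_bigr => e _.
by rewrite sumr_const (eqP (valP e)).
Qed.

Lemma sum_star1_le (R : realType) (n : nat) (i : 'I_n) :
  \sum_(e : edge n | i \in val e) 1 <= n%:R :> R.
Proof.
rewrite -(sum_star (fun=> 1)) -[n in leRHS]card_ord -sumr_const ler_sum// => j _.
by case: insubP.
Qed.

(** Consequently distinct edges share at most one vertex, and a three-star has a unique centre. *)
Lemma edge_inter_inj (n : nat) (e f : edge n) (u v : 'I_n) :
  u != v -> u \in val e -> v \in val e -> u \in val f -> v \in val f -> e = f.
Proof.
move=> uv ue ve uf vf; apply: val_inj.
have card_uv : #|[set u; v]%SET| = 2 by rewrite cards2 uv.
have E (g : edge n) : u \in val g -> v \in val g -> [set u; v]%SET = val g.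
  move=> ug vg; apply/eqP; rewrite eqEcard card_uv (eqP (valP g)) leqnn andbT.
  by apply/fintype.subsetP => w; rewrite !inE => /orP[] /eqP ->.
by rewrite -(E e)// -(E f).
Qed.

Lemma sum_indic_eq (R : pzSemiRingType) (T : finType) (a : T) :
  \sum_b (a == b)%:R = 1 :> R.
Proof.
rewrite (bigD1 a)//= eqxx big1 ?addr0// => b.
by rewrite eq_sym => /negbTE ->.
Qed.

Section degrees.
Context (R : realType) (n : nat) (x : config R n) (B : R).
Context (weight_le : forall e, `|weight x e| <= B) (B0 : 0 <= B).

Definition degree (i : 'I_n) : R := \sum_j weight_mx x i j.

Lemma weight_mxC i j : weight_mx x i j = weight_mx x j i.
Proof. by rewrite !mxE finset.setUC. Qed.

Lemma weight_mx_diag i : weight_mx x i i = 0.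
Proof. by rewrite mxE insubN// finset.setUid cards1. Qed.

Lemma weight_mx_le i j : `|weight_mx x i j| <= B.
Proof. by rewrite mxE; case: insubP => [e _ _|_] //=; rewrite normr0. Qed.

Lemma degreeE i : degree i = \sum_(e : edge n | i \in val e) weight x e.
Proof.
by rewrite -(sum_star (weight x)); apply: eq_bigr => j _; rewrite mxE.
Qed.

Lemma degree_le i : `|degree i| <= n%:R * B.
Proof.
rewrite (le_trans (ler_norm_sum _ _ _))//.
rewrite (le_trans (ler_sum _ (fun j _ => weight_mx_le i j)))//.
by rewrite sumr_const card_ord mulr_natl.
Qed.

Lemma sum_upper_weight_mx :
  \sum_(i < n) \sum_(j < n | (i < j)%N) weight_mx x i j = 2^-1 * \sum_i degree i.
Proof.
have -> : \sum_i degree i =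
    \sum_(i < n) \sum_(j < n | (i < j)%N) weight_mx x i j +
    \sum_(i < n) \sum_(j < n | (j < i)%N) weight_mx x i j.
  rewrite -big_split; apply: eq_bigr => i _ /=.
  rewrite /degree (bigD1 i)//= weight_mx_diag add0r.
  rewrite (bigID (fun j : 'I_n => (i < j)%N))/=; congr (_ + _); apply: eq_bigl => j.
    by rewrite andb_idl// => ij; rewrite -val_eqE/= gtn_eqF.
  by rewrite -leqNgt ltn_neqAle -val_eqE.
rewrite [X in _ + X](exchange_big_dep predT)//=.
under [X in _ + X]eq_bigr do under eq_bigr do rewrite weight_mxC.
by rewrite -mulr2n -[X in _ * X]mulr_natl mulKf// pnatr_eq0.
Qed.

(** In the expansion of the cube, the triples kept in the star sum cancel and those containing [i]
    vanish by the zero diagonal. The others have a coincidence among [j], [k], [l]; each of the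
    three kinds accounts for [n^2] triples. *)
Lemma cube_degree_approx i :
  `|\sum_j \sum_k \sum_(l < n | uniq [:: i; j; k; l])
      weight_mx x i j * weight_mx x i k * weight_mx x i l - degree i ^+ 3|
  <= 3 * n%:R ^+ 2 * B ^+ 3.
Proof.
set g := weight_mx x i.
have -> : degree i ^+ 3 = \sum_j \sum_k \sum_l g j * g k * g l.
  rewrite /degree -/g !exprS expr0 mulr1 mulrA big_distrlr/=.
  rewrite mulr_suml; apply: eq_bigr => j _; rewrite mulr_suml; apply: eq_bigr => k _.
  by rewrite mulr_sumr.
rewrite -sumrB.
apply: (@le_trans _ _ (\sum_j \sum_k \sum_l
    ((j == k)%:R + (j == l)%:R + (k == l)%:R) * B ^+ 3)).
  rewrite (le_trans (ler_norm_sum _ _ _))//; apply: ler_sum => j _.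
  rewrite -sumrB (le_trans (ler_norm_sum _ _ _))//; apply: ler_sum => k _.
  rewrite big_mkcond -sumrB (le_trans (ler_norm_sum _ _ _))//; apply: ler_sum => l _.
  have gB m : `|g m| <= B by exact: weight_mx_le.
  have gi : g i = 0 by exact: weight_mx_diag.
  have gB3 : `|g j * g k * g l| <= B ^+ 3.
    by rewrite !normrM !exprS expr0 mulr1 mulrA !ler_pM// mulr_ge0.
  have B30 : 0 <= B ^+ 3 by exact: exprn_ge0.
  case: ifPn => [_|U].
    by rewrite subrr normr0 mulr_ge0// !addr_ge0.
  rewrite sub0r normrN.
  have [->|ij] := eqVneq j i; first by rewrite gi !mul0r normr0 mulr_ge0// !addr_ge0.
  have [->|ik] := eqVneq k i; first by rewrite gi mulr0 mul0r normr0 mulr_ge0// !addr_ge0.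
  have [->|il] := eqVneq l i; first by rewrite gi mulr0 normr0 mulr_ge0// !addr_ge0.
  rewrite (le_trans gB3)// ler_peMl//.
  move: U; rewrite /= !inE !(eq_sym i) (negbTE ij) (negbTE ik) (negbTE il) /= andbT.
  rewrite negb_and negb_or negbK -natrD -natrD -[1]/(1%:R) ler_nat.
  by case: (j == k); case: (j == l); case: (k == l).
under eq_bigr => j _.
  under eq_bigr => k _.
    rewrite -mulr_suml big_split/= big_split/= !sum_indic_eq sumr_const card_ord.
    over.
  rewrite -mulr_suml big_split/= big_split/= sumrMnl sum_indic_eq !sumr_const card_ord.
  over.
by rewrite sumr_const card_ord -mulr_natl; lra.
Qed.

Definition local_energy (beta h d : R) : R := 2 * beta / 3 * d ^+ 3 + h * d.

(** The linear part is exact, each weight entering two degrees. The cubic part errs by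
    [cube_degree_approx] at each of the [n] vertices, times the prefactor [|beta| / (3 * n^2)]. *)
Lemma hamiltonian_approx beta h : (0 < n)%N ->
  `|hamiltonian beta h x
    - n%:R / 2 * \sum_i local_energy beta h (degree i / n%:R)|
  <= `|beta| * B ^+ 3 * n%:R.
Proof.
move=> n0; have n0' : n%:R != 0 :> R by rewrite pnatr_eq0 -lt0n.
have np : 0 < n%:R :> R by rewrite ltr0n.
rewrite /hamiltonian sum_upper_weight_mx.
set S := (X in _ * X + _ - _).
have -> : n%:R / 2 * \sum_i local_energy beta h (degree i / n%:R) =
    beta / (3 * n%:R ^+ 2) * (\sum_i degree i ^+ 3) + h * (2^-1 * \sum_i degree i).
  rewrite 3!mulr_sumr mulr_sumr -big_split; apply: eq_bigr => i _ /=.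
  by rewrite /local_energy; field.
rewrite opprD addrACA subrr addr0 -mulrBr normrM.
have -> : `|beta| * B ^+ 3 * n%:R =
    `|beta / (3 * n%:R ^+ 2)| * (n%:R * (3 * n%:R ^+ 2 * B ^+ 3)).
  rewrite normrM [`|(_ * _)^-1|]gtr0_norm; last by rewrite invr_gt0 mulr_gt0// exprn_gt0.
  by field.
rewrite ler_wpM2l// /S -sumrB (le_trans (ler_norm_sum _ _ _))//.
rewrite (le_trans (ler_sum _ (fun i _ => cube_degree_approx i)))//.
by rewrite sumr_const card_ord -[_ *+ n]mulr_natl.
Qed.

(** The sum counts the common vertices. For distinct edges there is at most one, so the left side is
    0; otherwise [three_star] is false and some coincidence indicator on the right is 1. *)
Lemma three_star_approx (e e1 e2 : edge n) :
  `|(three_star e e1 e2)%:R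
    - \sum_(v in val e) ((v \in val e1) && (v \in val e2))%:R|
  <= \sum_(v in val e) ((v \in val e1) && (v \in val e2))%:R *
      ((e == e1)%:R + (e == e2)%:R + (e1 == e2)%:R) :> R.
Proof.
have pos : 0 <= \sum_(v in val e) ((v \in val e1) && (v \in val e2))%:R *
      ((e == e1)%:R + (e == e2)%:R + (e1 == e2)%:R) :> R.
  by apply: sumr_ge0 => v _; rewrite mulr_ge0// !addr_ge0.
rewrite /three_star.
have [D|D] : [&& e != e1, e != e2 & e1 != e2] \/
    [|| e == e1, e == e2 | e1 == e2].
  by apply/orP; case: (e == e1); case: (e == e2); case: (e1 == e2).
all: swap 1 2.
  rewrite (_ : [&& _, _, _ & _] = false); last first.
    by move: D; case: (e == e1); case: (e == e2); case: (e1 == e2).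
  rewrite sub0r normrN ger0_norm; last by apply: sumr_ge0.
  apply: ler_sum => v _; rewrite ler_peMr// -!natrD -[1]/(1%:R) ler_nat.
  by move: D; case: (e == e1); case: (e == e2); case: (e1 == e2).
move: (D) => /and3P[D1 D2 D3]; rewrite D1 D2 D3/=.
have [/existsP[v /and3P[ve v1 v2]]|/existsPn N] :=
  boolP [exists v : 'I_n, [&& v \in val e, v \in val e1 & v \in val e2]].
  rewrite (bigD1 v)//= v1 v2 big1 ?addr0 ?subrr ?normr0// => w /andP[we wv].
  case: (boolP (w \in val e1)) => //= w1.
  by case/eqP: D1; exact: (edge_inter_inj wv).
rewrite big1 ?subrr ?normr0// => v ve.
by have := N v; rewrite ve /= => /negbTE ->.
Qed.

(** Without the distinctness constraint, the sum over [e1], [e2] through an endpoint [v] is the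
    squared degree of [v]. Each of the two endpoints has three kinds of coincidence, each met by at
    most [n] pairs, whence the factor 6. *)
Lemma local_field_approx (e : edge n) : (0 < n)%N ->
  `|local_field x e - \sum_(v in val e) (degree v / n%:R) ^+ 2|
  <= 6 * B ^+ 2 / n%:R.
Proof.
move=> n0; have n0' : n%:R != 0 :> R by rewrite pnatr_eq0 -lt0n.
have np : 0 < n%:R :> R by rewrite ltr0n.
have nE : local_field x e = n%:R ^- 2 *
    \sum_(e1 : edge n) \sum_(e2 : edge n)
      (three_star e e1 e2)%:R * (weight x e1 * weight x e2).
  rewrite /local_field mulr_sumr; apply: eq_bigr => e1 _.
  rewrite mulr_sumr; apply: eq_bigr => e2 _; rewrite /coupling -mulrA.
  by case: three_star; rewrite ?mul1r// !mul0r mulr0.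
have dE : \sum_(v in val e) (degree v / n%:R) ^+ 2 = n%:R ^- 2 *
    \sum_(e1 : edge n) \sum_(e2 : edge n)
      (\sum_(v in val e) ((v \in val e1) && (v \in val e2))%:R) *
      (weight x e1 * weight x e2).
  under eq_bigr do rewrite exprMn exprVn mulrC.
  rewrite -mulr_sumr; congr (_ * _).
  have dw v : degree v = \sum_(f : edge n) (v \in val f)%:R * weight x f.
    rewrite degreeE big_mkcond; apply: eq_bigr => f _.
    by case: (v \in val f); rewrite ?mul1r ?mul0r.
  under eq_bigr do rewrite expr2 !dw big_distrlr/=.
  rewrite exchange_big; apply: eq_bigr => e1 _.
  rewrite exchange_big; apply: eq_bigr => e2 _.
  rewrite mulr_suml; apply: eq_bigr => v _.
  by rewrite mulrACA -natrM mulnb.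
rewrite nE dE -mulrBr normrM ger0_norm ?invr_ge0 ?exprn_ge0//.
have -> : 6 * B ^+ 2 / n%:R = n%:R ^- 2 * (6 * n%:R * B ^+ 2) by field.
rewrite ler_wpM2l ?invr_ge0 ?exprn_ge0//.
apply: (@le_trans _ _ (\sum_(e1 : edge n) \sum_(e2 : edge n)
  (\sum_(v in val e) ((v \in val e1) && (v \in val e2))%:R *
      ((e == e1)%:R + (e == e2)%:R + (e1 == e2)%:R)) * B ^+ 2)).
  rewrite -sumrB (le_trans (ler_norm_sum _ _ _))//; apply: ler_sum => e1 _.
  rewrite -sumrB (le_trans (ler_norm_sum _ _ _))//; apply: ler_sum => e2 _.
  rewrite -mulrBl normrM ler_pM//; first exact: three_star_approx.
  by rewrite normrM expr2 ler_pM.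
under eq_bigr do rewrite -mulr_suml.
rewrite -mulr_suml ler_wpM2r ?sqr_ge0//.
under eq_bigr do rewrite exchange_big/=.
rewrite exchange_big/=.
have -> : 6 * n%:R = \sum_(v in val e) (3 * n%:R) :> R.
  by rewrite sumr_const (eqP (valP e)); lra.
apply: ler_sum => v ve.
have S1 : \sum_(f : edge n) (v \in val f)%:R <= n%:R :> R.
  rewrite (le_trans _ (sum_star1_le R v))// [leRHS]big_mkcond/=.
  by apply: ler_sum => f _; case: (v \in val f).
have I1 (a b : bool) : (a && b)%:R <= a%:R :> R by case: a; case: b.
have I2 (a b : bool) : (a && b)%:R <= b%:R :> R by case: a; case: b.
have -> : \sum_(e1 : edge n) \sum_(e2 : edge n)
   ((v \in val e1) && (v \in val e2))%:R *
      ((e == e1)%:R + (e == e2)%:R + (e1 == e2)%:R) =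
   \sum_(e1 : edge n) \sum_(e2 : edge n) (e == e1)%:R * ((v \in val e1) && (v \in val e2))%:R
   + \sum_(e1 : edge n) \sum_(e2 : edge n) (e == e2)%:R * ((v \in val e1) && (v \in val e2))%:R
   + \sum_(e1 : edge n) \sum_(e2 : edge n) (e1 == e2)%:R * ((v \in val e1) && (v \in val e2))%:R :> R.
  rewrite -!big_split; apply: eq_bigr => e1 _; rewrite -!big_split; apply: eq_bigr => e2 _ /=.
  by rewrite mulrC !mulrDl.
have D (T : finType) (a : T) (F : T -> R) : \sum_b (a == b)%:R * F b = F a.
  rewrite (bigD1 a)//= eqxx mul1r big1 ?addr0// => b.
  by rewrite eq_sym => /negbTE ->; rewrite mul0r.
have -> : 3 * n%:R = n%:R + n%:R + n%:R :> R by ring.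
rewrite lerD// ?lerD//.
- under eq_bigr do rewrite -mulr_sumr.
  by rewrite D (le_trans _ S1)//; apply: ler_sum => f _; exact: I2.
- under eq_bigr do rewrite D.
  by rewrite (le_trans _ S1)//; apply: ler_sum => f _; exact: I1.
- under eq_bigr do rewrite D.
  by rewrite (le_trans _ S1)//; apply: ler_sum => f _; exact: I1.
Qed.

Lemma sum_sqr_sub_mean (T : finType) (m : T -> R) (a : R) : (0 < #|T|)%N ->
  \sum_e (m e - #|T|%:R^-1 * \sum_f m f) ^+ 2 <= \sum_e (m e - a) ^+ 2.
Proof.
move=> T0; have T0' : #|T|%:R != 0 :> R by rewrite pnatr_eq0 -lt0n.
set b := _^-1 * _.
have b0 : \sum_e (m e - b) = 0.
  by rewrite sumrB sumr_const -mulr_natl /b mulVKf// subrr.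
have -> : \sum_e (m e - a) ^+ 2 =
    \sum_e ((m e - b) ^+ 2 + (2 * (b - a) * (m e - b) + (b - a) ^+ 2)).
  by apply: eq_bigr => e _; move: (m e) b {b0} => u b; ring.
rewrite big_split/= lerDl big_split/= -mulr_sumr b0 mulr0 add0r.
by apply: sumr_ge0 => e _; exact: sqr_ge0.
Qed.

(** The field of an edge [ij] is close to [d i ^+ 2 + d j ^+ 2]. The empirical mean is the best
    centring constant, so it may be replaced by [2 * d k ^+ 2] for any reference vertex [k];
    averaging over [k] produces the double sum. *)
Lemma field_variance_le : (1 < n)%N ->
  'C(n, 2)%:R * field_variance x <=
  12 * B ^+ 2 * (\sum_i \sum_k (degree i / n%:R - degree k / n%:R) ^+ 2)
  + 3 * 'C(n, 2)%:R * (6 * B ^+ 2 / n%:R) ^+ 2.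
Proof.
move=> n1; have n0 : (0 < n)%N by exact: ltnW.
have np : 0 < n%:R :> R by rewrite ltr0n.
have N0 : 'C(n, 2)%:R != 0 :> R by rewrite pnatr_eq0 -lt0n bin_gt0.
pose d i := degree i / n%:R.
have dB i : `|d i| <= B.
  by rewrite normrM normfV [`|n%:R|]ger0_norm// ler_pdivrMr// mulrC degree_le.
rewrite /field_variance mulrA mulfV// mul1r /mean_field.
set r := 6 * B ^+ 2 / n%:R.
have H k : \sum_(e : edge n) (local_field x e - 'C(n, 2)%:R^-1 * \sum_(e0 : edge n) local_field x e0) ^+ 2
   <= 12 * B ^+ 2 * n%:R * (\sum_i (d i - d k) ^+ 2) + 3 * 'C(n, 2)%:R * r ^+ 2.
  rewrite -card_edge.
  apply: (le_trans (sum_sqr_sub_mean _ (2 * d k ^+ 2) _)).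
    by rewrite card_edge bin_gt0.
  apply: (@le_trans _ _ (\sum_(e : edge n) (12 * B ^+ 2 * (\sum_(v in val e) (d v - d k) ^+ 2) + 3 * r ^+ 2))).
    apply: ler_sum => e _.
    have := local_field_approx e n0; rewrite -/r.
    have /cards2P[i [j [ij eij]]] := valP e.
    have E (F : 'I_n -> R) : \sum_(v in val e) F v = F i + F j.
      by rewrite eij big_setU1 ?inE//= big_set1.
    rewrite !E -/(d i) -/(d j).
    move: (local_field x e) => m.
    have sq v : (d v ^+ 2 - d k ^+ 2) ^+ 2 <= 4 * B ^+ 2 * (d v - d k) ^+ 2.
      rewrite subr_sqr exprMn mulrC ler_wpM2r ?sqr_ge0//.
      have -> : 4 * B ^+ 2 = (2 * B) ^+ 2 by ring.
      rewrite -[leLHS]real_normK ?num_real// lerXn2r ?nnegrE// ?mulr_ge0//.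
      rewrite (le_trans (ler_normD _ _))//.
      by have := dB v; have := dB k; lra.
    have := sq i; have := sq j.
    set p := d i ^+ 2 - _; set q := d j ^+ 2 - _ => hq hp hm.
    have hm2 : (m - (d i ^+ 2 + d j ^+ 2)) ^+ 2 <= r ^+ 2.
      rewrite -[leLHS]real_normK ?num_real// lerXn2r ?nnegrE//.
      by rewrite (le_trans _ hm).
    (* The square of a sum of three terms is at most three times the sum of squares; with the factor
       [4 * B ^+ 2] of [sq] this gives [12 * B ^+ 2]. *)
    have -> : m - 2 * d k ^+ 2 = (m - (d i ^+ 2 + d j ^+ 2)) + p + q by rewrite /p /q; ring.
    move: hm2; move: (m - _) => w hw.
    apply: (@le_trans _ _ (3 * (w ^+ 2 + p ^+ 2 + q ^+ 2))); last by lra.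
    have := sqr_ge0 (w - p); have := sqr_ge0 (w - q); have := sqr_ge0 (p - q).
    by rewrite !sqrrB !sqrrD; lra.
  rewrite big_split/= sumr_const card_edge -[_ *+ 'C(n, 2)]mulr_natl lerD//; last first.
    by rewrite mulrCA mulrA.
  rewrite -mulr_sumr -[leRHS]mulrA ler_wpM2l ?mulr_ge0 ?sqr_ge0//.
  rewrite -(sum_edge_incidence (fun _ v => (d v - d k) ^+ 2)) mulr_sumr.
  apply: ler_sum => v _.
  rewrite (eq_bigr (fun=> 1 * (d v - d k) ^+ 2)); last by move=> e _; rewrite mul1r.
  by rewrite -mulr_suml ler_wpM2r ?sqr_ge0// sum_star1_le.
have -> : \sum_i \sum_k (degree i / n%:R - degree k / n%:R) ^+ 2 =
    \sum_k \sum_i (d i - d k) ^+ 2 by rewrite exchange_big.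
rewrite -(ler_pM2l np) [leLHS]mulr_natl -[X in _ *+ X]card_ord -sumr_const.
apply: (le_trans (ler_sum _ (fun k _ => H k))).
rewrite big_split/= sumr_const card_ord -mulr_sumr -[(_ * _) *+ n]mulr_natl.
move: (\sum_k _) n%:R 'C(n, 2)%:R => S c N.
by rewrite le_eqVlt; apply/orP; left; apply/eqP; ring.
Qed.

End degrees.

(** * The mean-field energy on a finite net of tilts *)

Lemma discrete_IVT (R : realDomainType) (c : nat -> R) (m : nat) (d eta : R) :
  0 <= eta -> c 0%N <= d <= c m ->
  (forall k, (k < m)%N -> `|c k.+1 - c k| <= eta) ->
  exists2 k, (k <= m)%N & `|d - c k| <= eta.
Proof.
move=> eta0; elim: m => [|m IH] /andP[c0d dcm] step.
  by exists 0%N => //; rewrite (le_anti (x := d) (y := c 0%N)) ?subrr ?normr0 ?dcm.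
have [dm|md] := leP d (c m).
  have [||k km ?] := IH.
  - by rewrite c0d.
  - by move=> k km; apply: step; exact: ltnW.
  by exists k => //; exact: leqW.
exists m.+1 => //; apply: le_trans (step m (ltnSn m)).
by rewrite distrC !ger0_norm ?subr_ge0 ?lerD2l ?lerN2 ?(ltW md)// (le_trans (ltW md)).
Qed.

Section energy_net.
Context (R : realType) (mu : probability (measurableTypeR R) R).
Context (B : R) (B0 : 0 <= B) (muB : mu `[- B, B]%classic = 1%E).
Context (beta h : R).
Local Notation c := (tilted_mean mu).
Local Notation phi := (local_energy beta h).

(** A bound on [[- B, B]] for the derivative [2 * beta * d ^+ 2 + h] of [local_energy beta h]. *)
Definition energy_lipschitz : R := 2 * `|beta| * B ^+ 2 + `|h|.

Lemma energy_lipschitz_ge0 : 0 <= energy_lipschitz.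
Proof. by rewrite addr_ge0// mulr_ge0 ?sqr_ge0// mulr_ge0. Qed.

Lemma local_energy_lipschitz d e : `|d| <= B -> `|e| <= B ->
  `|phi d - phi e| <= energy_lipschitz * `|d - e|.
Proof.
move=> dB eB.
have -> : phi d - phi e = (2 * beta / 3 * (d ^+ 2 + d * e + e ^+ 2) + h) * (d - e).
  by rewrite /local_energy; field.
rewrite normrM ler_wpM2r// (le_trans (ler_normD _ _))// lerD2r.
have -> : 2 * beta / 3 * (d ^+ 2 + d * e + e ^+ 2) =
    2 * beta * ((d ^+ 2 + d * e + e ^+ 2) / 3) by field.
rewrite !normrM [`|2|]ger0_norm// ler_wpM2l ?mulr_ge0//.
rewrite [`|3^-1|]ger0_norm ?invr_ge0// ler_pdivrMr//.
have -> : B ^+ 2 * 3 = B ^+ 2 + B * B + B ^+ 2 by ring.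
rewrite (le_trans (ler_normD _ _))// lerD//; last first.
  by rewrite normrX lerXn2r ?nnegrE.
rewrite (le_trans (ler_normD _ _))// lerD//.
  by rewrite normrX lerXn2r ?nnegrE.
by rewrite normrM ler_pM.
Qed.

Lemma tilted_mean_net (K eta : R) : 0 <= K -> 0 < eta ->
  exists (m : nat) (t : nat -> R),
    [/\ forall k, (k <= m)%N -> `|t k| <= K, t 0%N = - K, t m = K &
        forall k, (k < m)%N -> `|c (t k.+1) - c (t k)| <= eta].
Proof.
(* Equally spaced tilts at distance [2 * K / m] have means whose squared difference is at most
   [8 * B ^+ 3 * K / m]; this is below [eta ^+ 2] as soon as [m > b]. *)
move=> K0 eta0; pose b := 8 * B ^+ 3 * K / eta ^+ 2.
have b0 : 0 <= b by rewrite divr_ge0 ?sqr_ge0// !mulr_ge0// exprn_ge0.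
pose m := (Num.truncn b).+1.
have bm : b < m%:R by exact: truncnS_gt.
have m0 : 0 < m%:R :> R by rewrite ltr0n.
pose t k := - K + 2 * K * (k%:R / m%:R).
exists m, t; split.
- move=> k km; have k1 : k%:R / m%:R <= 1 :> R by rewrite ler_pdivrMr// mul1r ler_nat.
  have k0 : 0 <= k%:R / m%:R :> R by rewrite divr_ge0.
  have : 0 <= K * (k%:R / m%:R) by exact: mulr_ge0.
  have : 0 <= K * (1 - k%:R / m%:R) by rewrite mulr_ge0// subr_ge0.
  by rewrite /t ler_norml => h1 h2; apply/andP; split; lra.
- by rewrite /t mul0r mulr0 addr0.
- by rewrite /t divff ?gt_eqF//; ring.
move=> k km.
have tk : t k.+1 - t k = 2 * K / m%:R.
  by rewrite /t -natr1; field; rewrite gt_eqF.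
rewrite -[leRHS]ger0_norm ?(ltW eta0)// -ler_sqr ?nnegrE// !real_normK ?num_real//.
apply: (le_trans (sqr_tilted_mean_gap B0 muB _ _)).
apply: (@le_trans _ _ (8 * B ^+ 2 * (B * `|t k.+1 - t k| / 2))).
  by rewrite ler_wpM2l ?mulr_ge0 ?sqr_ge0//; exact: log_mgf_gap_le muB _ _.
rewrite tk ger0_norm; last by rewrite divr_ge0 ?mulr_ge0// ltW.
have -> : 8 * B ^+ 2 * (B * (2 * K / m%:R) / 2) = b * eta ^+ 2 / m%:R.
  by rewrite /b; field; rewrite !gt_eqF.
by rewrite ler_pdivrMr// mulrC ler_wpM2l ?sqr_ge0// ltW.
Qed.

(** The tilts run over [[- K, K]] with [K = energy_lipschitz + 1]. If [d] is beyond the mean of an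
    extreme tilt, the slope [K] there pays for both the Lipschitz growth of the energy and the
    penalty [|d - c|]. Otherwise some mean is within [eta] of [d]. *)
Lemma local_energy_net (eta : R) : 0 < eta ->
  exists (m : nat) (t : 'I_m.+1 -> R),
    (forall k, `|t k| <= energy_lipschitz + 1) /\
    forall d, `|d| <= B -> exists k,
      phi d <= phi (c (t k)) + t k * (d - c (t k)) - `|d - c (t k)|
        + 2 * (energy_lipschitz + 1) * eta.
Proof.
move=> eta0; set l := energy_lipschitz; have l0 : 0 <= l := energy_lipschitz_ge0.
have K0 : 0 <= l + 1 by rewrite addr_ge0.
have [m [t [tK t0 tm step]]] := tilted_mean_net K0 eta0.
exists m, (fun k : 'I_m.+1 => t k); split=> [k|d dB].
  by apply: tK; rewrite -ltnS.
have cB s : `|c s| <= B by exact: tilted_mean_bounded.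
have lip s := ler_normlW (local_energy_lipschitz dB (cB s)).
have eta' : 0 <= 2 * (l + 1) * eta by rewrite mulr_ge0 ?mulr_ge0// ltW.
have [dl|ld] := leP d (c (t 0%N)).
  exists ord0 => /=; have := lip (t 0%N); rewrite -/l.
  move: dl; rewrite t0; set e := c _ => dl.
  rewrite ler0_norm ?subr_le0//; move: (phi d) (phi e) => p q; lra.
have [ud|du] := leP (c (t m)) d.
  exists ord_max => /=; have := lip (t m); rewrite -/l.
  move: ud; rewrite tm; set e := c _ => ud.
  rewrite ger0_norm ?subr_ge0//; move: (phi d) (phi e) => p q; lra.
(* The energy, the linear term and the penalty cost at most [l * eta], [(l + 1) * eta] and [eta],
   together [2 * (l + 1) * eta]. *)
have [||k km dk] := discrete_IVT (c := fun k => c (t k)) (m := m) (d := d) (ltW eta0).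
- by rewrite (ltW ld) (ltW du).
- exact: step.
have km' : (k < m.+1)%N by [].
exists (Ordinal km') => /=; have := lip (t k); rewrite -/l.
have := tK _ km; move: dk; set e := c _; set y := d - e => yeta tkK.
have h1 : l * `|y| <= l * eta by rewrite ler_wpM2l.
have h2 : - (t k * y) <= (l + 1) * eta.
  rewrite (le_trans (ler_norm _))// normrN normrM.
  by rewrite ler_pM.
move: (phi d) (phi e) `|y| h1 h2 yeta => p q z h1 h2 yeta; lra.
Qed.

End energy_net.

(** * Upper bound on the Hamiltonian by tilted product densities *)

Definition edge_tilt (R : realType) (n : nat) (t : 'I_n -> R) (e : edge n) : R :=
  (\sum_(v in val e) t v) / 2.

Lemma sum_add_pair (R : realType) (n : nat) (u : 'I_n -> R) :
  \sum_i \sum_j (u i + u j) = 2 * n%:R * \sum_i u i.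
Proof.
under eq_bigr do rewrite big_split/= sumr_const card_ord.
rewrite big_split/= sumr_const card_ord sumrMnl -[_ *+ n]mulr_natl.
by move: (\sum_i _) => S; ring.
Qed.

Section upper_bound.
Context (R : realType) (mu : probability (measurableTypeR R) R).
Context (B : R) (B0 : 0 < B) (muB : mu `[- B, B]%classic = 1%E).
Context (n : nat) (n0 : (0 < n)%N).
Local Notation c := (tilted_mean mu).
Local Notation L := (log_mgf mu).
Local Notation gap := (log_mgf_gap mu).

Lemma sum_edge_tilt_weight (t : 'I_n -> R) (x : config R n) :
  \sum_(e : edge n) edge_tilt t e * weight x e = 2^-1 * \sum_i t i * degree x i.
Proof.
under [in RHS]eq_bigr do rewrite degreeE mulr_sumr.
rewrite sum_edge_incidence mulr_sumr; apply: eq_bigr => e _.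
by rewrite /edge_tilt mulrAC mulr_suml mulrC.
Qed.

(** The definition of the gap is summed over all ordered pairs: each edge occurs twice, and the
    diagonal, which carries no edge, leaves the last sum. *)
Lemma sum_edge_tilt_log_mgf (t : 'I_n -> R) :
  n%:R / 2 * \sum_i L (t i) = \sum_(e : edge n) L (edge_tilt t e) +
    2^-1 * \sum_i \sum_j gap (t i) (t j) + 2^-1 * \sum_i L (t i).
Proof.
pose F (e : edge n) := L (edge_tilt t e).
have -> : \sum_(e : edge n) L (edge_tilt t e) =
    2^-1 * \sum_i \sum_j oapp F 0 (insub [set i; j]%SET).
  by rewrite sum_pairs_edges -[X in _ * X]mulr_natl mulKf// pnatr_eq0.
have H i j : (L (t i) + L (t j)) / 2 =
    oapp F 0 (insub [set i; j]%SET) + gap (t i) (t j) + (i == j)%:R * L (t i).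
  have [<-|ij] := eqVneq i j.
    rewrite insubN ?finset.setUid ?cards1// /log_mgf_gap/= mul1r.
    have -> : (t i + t i) / 2 = t i by field.
    by move: (L _) => p; field.
  rewrite mul0r addr0; case: insubP => [e _ Ee|]; last by rewrite cards2 ij.
  rewrite /= /F /log_mgf_gap /edge_tilt Ee big_setU1 ?inE//= big_set1.
  by move: (L (t i)) (L (t j)) (L (_ / _)) => p q r; ring.
have : \sum_i \sum_j (L (t i) + L (t j)) / 2 = n%:R * \sum_i L (t i).
  under eq_bigr do rewrite -mulr_suml.
  rewrite -mulr_suml (sum_add_pair (fun i => L (t i))).
  by move: (\sum_i _) => S; field.
under eq_bigr do under eq_bigr do rewrite H.
have diagE i : \sum_j (i == j)%:R * L (t i) = L (t i).
  by rewrite -mulr_suml sum_indic_eq mul1r.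
under eq_bigr do rewrite big_split big_split/= diagE.
rewrite big_split big_split/=.
move: (\sum_i L _) (\sum_i \sum_j gap _ _) (\sum_i \sum_j oapp _ _ _) => S G O E.
by lra.
Qed.

Context (beta h M K delta : R) (x : config R n) (t : 'I_n -> R).
Context (weight_le : forall e, `|weight x e| <= B).
Context (tK : forall i, `|t i| <= K).
Local Notation d i := (degree x i / n%:R).
Context (energy_le : forall i,
  local_energy beta h (d i) <=
    M + t i * d i - L (t i) - `|d i - c (t i)| + delta).

Definition dispersion : R := \sum_i \sum_k (d i - d k) ^+ 2.

(** The difference [d i - d j] passes through the two tilted means. The difference of means is
    controlled by the gap, and [(d i - c (t i)) ^+ 2 <= 2 * B * |d i - c (t i)|] since both are
    bounded by [B]. *)
Lemma dispersion_le :
  dispersion <= (24 * B + 48 * B ^+ 2) *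
    (2^-1 * \sum_i \sum_j gap (t i) (t j) + n%:R / 2 * \sum_i `|d i - c (t i)|).
Proof.
have B0' := ltW B0.
have np : 0 < n%:R :> R by rewrite ltr0n.
have dB i : `|d i| <= B.
  rewrite normrM normfV [`|n%:R|]ger0_norm// ler_pdivrMr// mulrC.
  exact: degree_le.
have cB i : `|c (t i)| <= B by exact: tilted_mean_bounded.
have sq i : (d i - c (t i)) ^+ 2 <= 2 * B * `|d i - c (t i)|.
  rewrite -real_normK ?num_real// expr2 ler_wpM2r//.
  by rewrite (le_trans (ler_normB _ _))//; have := dB i; have := cB i; lra.
apply: (@le_trans _ _ (\sum_i \sum_j (24 * B ^+ 2 * gap (t i) (t j) +
    (6 * B * `|d i - c (t i)| + 6 * B * `|d j - c (t j)|)))).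
  apply: ler_sum => i _; apply: ler_sum => j _.
  have := sqr_tilted_mean_gap B0' muB (t i) (t j); have := sq i; have := sq j.
  move: (d i) (d j) (c (t i)) (c (t j)) (gap _ _) => p q r s g.
  move: `|_| `|_| => u v h1 h2 h3.
  rewrite (_ : p - q = (p - r) - (q - s) + (r - s)); last by ring.
  move: (p - r) (q - s) (r - s) h1 h2 h3 => X Y Z h1 h2 h3.
  apply: (@le_trans _ _ (3 * (X ^+ 2 + Y ^+ 2 + Z ^+ 2))); last by lra.
  rewrite -subr_ge0 (_ : _ - _ = (X + Y) ^+ 2 + (X - Z) ^+ 2 + (Y + Z) ^+ 2); last by ring.
  by rewrite !addr_ge0 ?sqr_ge0.
have G0 : 0 <= \sum_i \sum_j gap (t i) (t j).
  by apply: sumr_ge0 => i _; apply: sumr_ge0 => j _; exact: log_mgf_gap_ge0 muB _ _.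
have A0 : 0 <= n%:R * \sum_i `|d i - c (t i)|.
  by rewrite mulr_ge0// sumr_ge0.
under eq_bigr do rewrite big_split/= -mulr_sumr.
rewrite big_split/= -mulr_sumr (sum_add_pair (fun i => 6 * B * `|d i - c (t i)|)) -mulr_sumr.
move: (\sum_i \sum_j _) (\sum_i `|_|) G0 A0 => G A G0 A0.
(* The coefficients reached are [24 * B ^+ 2] on [G] and [12 * B] on [n%:R * A]; half of the stated
   constant is their sum, so it dominates both. *)
rewrite -subr_ge0.
have -> : (24 * B + 48 * B ^+ 2) * (2^-1 * G + n%:R / 2 * A) -
   (24 * B ^+ 2 * G + 2 * n%:R * (6 * B * A)) =
   12 * B * G + 24 * B ^+ 2 * (n%:R * A) by field.
by rewrite addr_ge0// mulr_ge0// ?mulr_ge0 ?sqr_ge0.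
Qed.

(** Summing [energy_le] over the vertices turns [t i * d i] into edge tilts and the [L (t i)] into
    edge normalizations plus gaps. The gaps and the penalties pay for the dispersion; the diagonal
    and the error of [hamiltonian_approx] are of order [n]. *)
Lemma hamiltonian_upper :
  hamiltonian beta h x <= n%:R ^+ 2 / 2 * (M + delta)
    + \sum_(e : edge n) (edge_tilt t e * weight x e - L (edge_tilt t e))
    - dispersion / (24 * B + 48 * B ^+ 2)
    + (`|beta| * B ^+ 3 + B * K / 2) * n%:R.
Proof.
have B0' := ltW B0.
have np : 0 < n%:R :> R by rewrite ltr0n.
have D0 : 0 < 24 * B + 48 * B ^+ 2 by rewrite addr_gt0// mulr_gt0// exprn_gt0.
have := dispersion_le; rewrite mulrC -ler_pdivrMr// => disp.
have := ler_normlW (hamiltonian_approx weight_le B0' beta h n0).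
have S : n%:R / 2 * \sum_i local_energy beta h (d i) <=
    n%:R / 2 * \sum_i (M + t i * d i - L (t i) - `|d i - c (t i)| + delta).
  by rewrite ler_wpM2l ?divr_ge0//; apply: ler_sum => i _; exact: energy_le.
have E : n%:R / 2 * \sum_i (M + t i * d i - L (t i) - `|d i - c (t i)| + delta) =
   n%:R ^+ 2 / 2 * (M + delta) + 2^-1 * \sum_i t i * degree x i
   - n%:R / 2 * \sum_i L (t i) - n%:R / 2 * \sum_i `|d i - c (t i)|.
  rewrite !big_split/= !sumrN !sumr_const card_ord -[M *+ n]mulr_natl -[delta *+ n]mulr_natl.
  have -> : \sum_i t i * degree x i = n%:R * \sum_i t i * d i.
    by rewrite mulr_sumr; apply: eq_bigr => i _; field; rewrite gt_eqF.
  by move: (\sum_i _) (\sum_i L _) (\sum_i `|_|) => p q r; field.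
have LK : - (2^-1 * \sum_i L (t i)) <= B * K / 2 * n%:R.
  rewrite (le_trans (ler_norm _))// normrN normrM [`|2^-1|]ger0_norm ?invr_ge0//.
  have -> : B * K / 2 * n%:R = 2^-1 * (n%:R * (B * K)) by field.
  rewrite ler_wpM2l ?invr_ge0// (le_trans (ler_norm_sum _ _ _))//.
  rewrite mulr_natl -[n in leRHS]card_ord -sumr_const; apply: ler_sum => i _.
  by rewrite (le_trans (log_mgf_bounded muB _))// ler_wpM2l.
move: S; rewrite E sum_edge_tilt_log_mgf -sum_edge_tilt_weight sumrB.
move: disp LK; rewrite [(_ + _) * n%:R]mulrDl.
move: (\sum_(e : edge n) edge_tilt t e * _) (\sum_(e : edge n) L _).
move: (n%:R / 2 * \sum_i `|_|) (2^-1 * \sum_i \sum_j _) (2^-1 * \sum_i L _).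
move: (n%:R / 2 * \sum_i local_energy _ _ _) (hamiltonian _ _ _).
move: (n%:R ^+ 2 / 2 * _) (dispersion / _) (`|beta| * _ * n%:R) (B * K / 2 * n%:R).
move=> *; lra.
Qed.

End upper_bound.

(** * Averages over configurations *)

HB.lock Definition config_average (R : realType) (n : nat)
  (mu : probability (measurableTypeR R) R) (g : config R n -> R) : R :=
  \int[product_power mu #|edge n|]_x g x.

Section config_measure.
Context (R : realType) (n : nat) (mu : probability (measurableTypeR R) R).
Local Notation P := (product_power mu #|edge n|).
Local Notation E := (config_average mu).

Definition config_averageable (g : config R n -> R) : Prop :=
  P.-integrable setT (EFin \o g).
Local Notation I := config_averageable.

Lemma config_averageableZ a g : I g -> I (fun x => a * g x).
Proof. exact: integrable_EFinZl. Qed.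

Lemma config_averageableD f g : I f -> I g -> I (fun x => f x + g x).
Proof. exact: integrable_EFinD. Qed.

Lemma config_averageableB f g : I f -> I g -> I (fun x => f x - g x).
Proof. exact: integrable_EFinB. Qed.

Lemma config_averageable_sum (J : Type) (s : seq J) (Q : pred J)
    (f : J -> config R n -> R) :
  (forall j, I (f j)) -> I (fun x => \sum_(j <- s | Q j) f j x).
Proof. exact: integrable_EFin_sum. Qed.

Lemma config_averageZ a g : I g -> E (fun x => a * g x) = a * E g.
Proof. by rewrite config_average.unlock; exact: RintegralZl. Qed.

Lemma config_averageD f g : I f -> I g -> E (fun x => f x + g x) = E f + E g.
Proof. by rewrite config_average.unlock; exact: RintegralD. Qed.

Lemma config_averageB f g : I f -> I g -> E (fun x => f x - g x) = E f - E g.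
Proof. by rewrite config_average.unlock; exact: RintegralB. Qed.

Lemma config_average_sum (J : Type) (s : seq J) (Q : pred J)
    (f : J -> config R n -> R) :
  (forall j, I (f j)) ->
  E (fun x => \sum_(j <- s | Q j) f j x) = \sum_(j <- s | Q j) E (f j).
Proof. by rewrite config_average.unlock; exact: Rintegral_sum. Qed.

Lemma config_average_prod (f : edge n -> R -> R) :
  (forall e, averageable mu (f e)) ->
  I (fun x => \prod_(e : edge n) f e (weight x e)) /\
  E (fun x => \prod_(e : edge n) f e (weight x e)) =
    \prod_(e : edge n) average mu (f e).
Proof.
move=> intf.
have [intP EP] := product_power_prod (fun i : 'I_#|edge n| => intf (enum_val i)).
have prodE (g : edge n -> R) :
    \prod_(e : edge n) g e = \prod_(i < #|edge n|) g (enum_val i).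
  by rewrite (reindex (@enum_val _ (mem (edge n))))//; exact: onW_bij (enum_val_bij _).
have FE : (fun x : config R n => \prod_(e : edge n) f e (weight x e)) =
    fun x => \prod_i f (enum_val i) (tnth x i).
  apply/funext => x; rewrite prodE; apply: eq_bigr => i _.
  by rewrite /weight enum_valK.
by rewrite /config_averageable FE prodE config_average.unlock average.unlock.
Qed.

Context (B : R) (B0 : 0 <= B) (muB : mu `[- B, B]%classic = 1%E).

Definition weight_box : set (config R n) :=
  [set x | forall e, `|weight x e| <= B].

Lemma weight_boxE : weight_box =
  [set x : config R n | forall i, (`[- B, B]%classic : set R) (tnth x i)].
Proof.
apply/seteqP; split => x H.
  by move=> i; have := H (enum_val i); rewrite /weight enum_valK ler_norml /= in_itv.
by move=> e; have := H (enum_rank e); rewrite /weight ler_norml /= in_itv.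
Qed.

Lemma measurable_weight_box : measurable weight_box.
Proof.
rewrite weight_boxE [X in measurable X](_ : _ = \bigcap_(i in [set: 'I_#|edge n|])
      ((@tnth _ (measurableTypeR R))^~ i @^-1` `[- B, B]%classic)); last first.
  by apply/seteqP; split => [x H i _|x H i] /=; [exact: H|exact: (H i)].
apply: fin_bigcap_measurable => // i _.
rewrite -[X in measurable X]setTI; apply: measurable_tnth => //.
Qed.

Lemma probability_weight_box : P weight_box = 1%E.
Proof.
have := @product_power_box _ _ R mu #|edge n| (fun=> `[- B, B]%classic)
    (fun=> measurable_itv `[- B, B]).
by rewrite weight_boxE big1.
Qed.

Lemma config_averageable_bounded (g : config R n -> R) (M : R) : measurable_fun setT g ->
  (forall x, weight_box x -> `|g x| <= M) -> I g.
Proof.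
exact: (bounded_integrable measurable_weight_box probability_weight_box).
Qed.

Lemma le_config_average (f g : config R n -> R) : I f -> I g ->
  (forall x, weight_box x -> f x <= g x) -> E f <= E g.
Proof.
rewrite config_average.unlock.
exact: (le_Rintegral_on measurable_weight_box probability_weight_box).
Qed.

(** The density, relative to the product of copies of [mu], of the product law whose marginal at [e]
    is [mu] tilted by [theta e]. *)
Definition config_tilt (theta : edge n -> R) (x : config R n) : R :=
  expR (\sum_(e : edge n) (theta e * weight x e - log_mgf mu (theta e))).

Lemma config_tiltE theta x :
  config_tilt theta x = \prod_(e : edge n) tilt mu (theta e) (weight x e).
Proof. by rewrite /config_tilt expR_sum; apply: eq_bigr => e _; rewrite tiltE. Qed.

Lemma config_averageable_tilt theta : I (config_tilt theta).
Proof.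
rewrite (_ : config_tilt theta =
    fun x => \prod_(e : edge n) tilt mu (theta e) (weight x e)).
  by have [] := config_average_prod (fun e => averageable_tilt muB (theta e)).
by apply/funext => x; rewrite config_tiltE.
Qed.

Lemma config_average_tilt theta : E (config_tilt theta) = 1.
Proof.
rewrite (_ : config_tilt theta =
    fun x => \prod_(e : edge n) tilt mu (theta e) (weight x e)).
  have [_ ->] := config_average_prod (fun e => averageable_tilt muB (theta e)).
  by rewrite big1// => e _; exact: average_tilt muB _.
by apply/funext => x; rewrite config_tiltE.
Qed.

(** Under the tilted law the weights of distinct edges are independent with mean
    [tilted_mean mu t]. *)
Lemma config_average_tilt_prod (t : R) (s : seq (edge n)) : uniq s ->
  I (fun x => (\prod_(e <- s) weight x e) * config_tilt (fun=> t) x) /\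
  E (fun x => (\prod_(e <- s) weight x e) * config_tilt (fun=> t) x) =
    tilted_mean mu t ^+ size s.
Proof.
move=> us; pose f e y := (if e \in s then y else 1) * tilt mu t y.
have intf e : averageable mu (f e).
  rewrite /f; case: (e \in s); first exact: averageable_id_tilt muB t.
  by under eq_fun do rewrite mul1r; exact: averageable_tilt muB t.
have avgf e : average mu (f e) = if e \in s then tilted_mean mu t else 1.
  rewrite /f; case: (e \in s) => //.
  by under eq_fun do rewrite mul1r; exact: average_tilt muB t.
have FE : (fun x => (\prod_(e <- s) weight x e) * config_tilt (fun=> t) x) =
    fun x => \prod_(e : edge n) f e (weight x e).
  apply/funext => x; rewrite /f big_split/= config_tiltE; congr (_ * _).
  by rewrite -big_mkcond/= big_uniq.
rewrite FE; have [int ->] := config_average_prod intf; split => //.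
under eq_bigr do rewrite avgf.
rewrite -big_mkcond/= prodr_const; congr (_ ^+ _).
exact: (card_uniqP us).
Qed.

End config_measure.

(** * Lower bound on the partition function *)

Definition pair_edge (n : nat) (i j : 'I_n) (ij : #|[set i; j]%SET| == 2) : edge n :=
  exist _ [set i; j]%SET ij.

Lemma weight_mx_pair (R : realType) (n : nat) (x : config R n) (i j : 'I_n)
    (ij : #|[set i; j]%SET| == 2) :
  weight_mx x i j = weight x (pair_edge ij).
Proof.
rewrite mxE; case: insubP => [e _ ve|/negP//] /=.
by congr weight; exact: val_inj.
Qed.

Section partition_function_bounds.
Context (R : realType) (n : nat) (mu : probability (measurableTypeR R) R).
Context (B : R) (B0 : 0 <= B) (muB : mu `[- B, B]%classic = 1%E).
Local Notation E := (config_average mu).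
Local Notation I := (config_averageable mu).
Local Notation L := (log_mgf mu).
Local Notation N := (#|edge n|%:R : R).

(** Integrability and value travel together, so that linear combinations are handled in one pass. *)
Definition has_average (f : config R n -> R) (v : R) : Prop := I f /\ E f = v.

Lemma has_averageZ a f v : has_average f v -> has_average (fun x => a * f x) (a * v).
Proof.
by move=> [intf <-]; split; [exact: config_averageableZ|exact: config_averageZ].
Qed.

Lemma has_averageD f g v w : has_average f v -> has_average g w ->
  has_average (fun x => f x + g x) (v + w).
Proof.
move=> [intf <-] [intg <-].
by split; [exact: config_averageableD|exact: config_averageD].
Qed.

Lemma has_averageB f g v w : has_average f v -> has_average g w ->
  has_average (fun x => f x - g x) (v - w).
Proof.
move=> [intf <-] [intg <-].
by split; [exact: config_averageableB|exact: config_averageB].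
Qed.

Lemma has_average_sum (J : Type) (s : seq J) (Q : pred J)
    (f : J -> config R n -> R) (v : J -> R) :
  (forall j, Q j -> has_average (f j) (v j)) ->
  has_average (fun x => \sum_(j <- s | Q j) f j x) (\sum_(j <- s | Q j) v j).
Proof.
move=> fv; pose g j x := if Q j then f j x else 0.
have gE j : has_average (g j) (if Q j then v j else 0).
  rewrite /g; case: ifP => Qj; first exact: fv.
  (* Indices outside [Q] get the zero function, written as a multiple of an integrable density. *)
  rewrite (_ : (fun _ => _) = fun x => 0 * config_tilt mu (fun=> 0) x).
    rewrite -[X in has_average _ X](mul0r 1); apply: has_averageZ.
    by split; [exact: config_averageable_tilt muB _|exact: config_average_tilt muB _].
  by apply/funext => x; rewrite mul0r.
rewrite [X in has_average _ X]big_mkcond/=.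
rewrite (_ : (fun _ => _) = fun x => \sum_(j <- s) g j x); last first.
  by apply/funext => x; rewrite big_mkcond.
split; first by apply: config_averageable_sum => j; have [] := gE j.
rewrite config_average_sum => [|j]; last by have [] := gE j.
by apply: eq_bigr => j _; have [] := gE j.
Qed.

Definition const_config (a : R) : config R n := [tuple a | _ < #|edge n|].

Lemma weight_const_config a e : weight (const_config a) e = a.
Proof. by rewrite /weight tnth_mktuple. Qed.

Context (beta h t : R).
Local Notation c := (tilted_mean mu t).
Local Notation W := (config_tilt mu (fun=> t)).

Lemma has_average_tilt : has_average W 1.
Proof.
by split; [exact: config_averageable_tilt muB _|exact: config_average_tilt muB _].
Qed.

Lemma has_average_weight_tilt (s : seq (edge n)) : uniq s ->
  has_average (fun x => (\prod_(e <- s) weight x e) * W x) (c ^+ size s).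
Proof. by move=> us; exact: (config_average_tilt_prod muB). Qed.

Lemma has_average_weight_mx i j : i != j ->
  has_average (fun x => weight_mx x i j * W x) (weight_mx (const_config c) i j).
Proof.
move=> ij; have ije : #|[set i; j]%SET| == 2 by rewrite cards2 ij.
rewrite (weight_mx_pair _ ije) weight_const_config.
rewrite (_ : (fun _ => _) = fun x => (\prod_(e <- [:: pair_edge ije]) weight x e) * W x).
  exact: has_average_weight_tilt.
by apply/funext => x; rewrite (weight_mx_pair _ ije) big_seq1.
Qed.

Lemma pair_edge_neq (i j k : 'I_n) (ij : #|[set i; j]%SET| == 2)
    (ik : #|[set i; k]%SET| == 2) :
  j != k -> pair_edge ij != pair_edge ik.
Proof.
move=> jk; apply/eqP => /(congr1 val) /= H.
have : j \in [set i; k]%SET by rewrite -H !inE eqxx orbT.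
rewrite !inE (negbTE jk) orbF => /eqP ji.
by move: ij; rewrite ji finset.setUid cards1.
Qed.

Lemma has_average_three_star i j k l : uniq [:: i; j; k; l] ->
  has_average
    (fun x => weight_mx x i j * weight_mx x i k * weight_mx x i l * W x)
    (weight_mx (const_config c) i j * weight_mx (const_config c) i k
     * weight_mx (const_config c) i l).
Proof.
rewrite /= !inE !negb_or andbT => /and3P[/and3P[ij ik il] /andP[jk jl] kl].
have ije : #|[set i; j]%SET| == 2 by rewrite cards2 ij.
have ike : #|[set i; k]%SET| == 2 by rewrite cards2 ik.
have ile : #|[set i; l]%SET| == 2 by rewrite cards2 il.
have WE x : weight_mx x i j * weight_mx x i k * weight_mx x i l =
    \prod_(e <- [:: pair_edge ije; pair_edge ike; pair_edge ile]) weight x e.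
  rewrite !big_cons big_nil mulr1 mulrA.
  by rewrite (weight_mx_pair _ ije) (weight_mx_pair _ ike) (weight_mx_pair _ ile).
rewrite (_ : (fun _ => _) = fun x =>
    (\prod_(e <- [:: pair_edge ije; pair_edge ike; pair_edge ile]) weight x e) * W x).
  rewrite WE !big_cons big_nil !weight_const_config.
  have -> : c * (c * (c * 1)) = c ^+ 3 by ring.
  apply: has_average_weight_tilt.
  by rewrite /= !inE negb_or !pair_edge_neq.
by apply/funext => x; rewrite WE.
Qed.

Lemma has_average_hamiltonian :
  has_average (fun x => hamiltonian beta h x * W x)
    (hamiltonian beta h (const_config c)).
Proof.
rewrite (_ : (fun _ => _) = fun x : config R n =>
  beta / (3 * n%:R ^+ 2) *
    (\sum_(i < n) \sum_(j < n) \sum_(k < n) \sum_(l < n | uniq [:: i; j; k; l])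
       weight_mx x i j * weight_mx x i k * weight_mx x i l * W x)
  + h * \sum_(i < n) \sum_(j < n | (i < j)%N) weight_mx x i j * W x).
  apply: has_averageD; apply: has_averageZ.
    apply: has_average_sum => i _; apply: has_average_sum => j _.
    apply: has_average_sum => k _; apply: has_average_sum => l.
    exact: has_average_three_star.
  apply: has_average_sum => i _; apply: has_average_sum => j ij.
  by apply: has_average_weight_mx; rewrite -val_eqE/= ltn_eqF.
apply/funext => x; rewrite /hamiltonian mulrDl -[_ * _ * W x]mulrA -[h * _ * W x]mulrA.
congr (_ * _ + _ * _).
  rewrite mulr_suml; apply: eq_bigr => i _; rewrite mulr_suml; apply: eq_bigr => j _.
  rewrite mulr_suml; apply: eq_bigr => k _; rewrite mulr_suml; apply: eq_bigr => l _.
  by [].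
rewrite mulr_suml; apply: eq_bigr => i _; rewrite mulr_suml.
by apply: eq_bigr => j _.
Qed.

Lemma has_average_log_tilt :
  has_average (fun x => (\sum_(e : edge n) (t * weight x e - L t)) * W x)
    (N * (t * c - L t)).
Proof.
rewrite (_ : (fun _ => _) = fun x : config R n =>
    \sum_(e : edge n) (t * (weight x e * W x) - L t * W x)).
  rewrite mulr_natl -sumr_const; apply: has_average_sum => e _.
  have -> : t * c - L t = t * c ^+ 1 - L t * 1 by rewrite expr1 mulr1.
  apply: has_averageB; apply: has_averageZ; last exact: has_average_tilt.
  have := @has_average_weight_tilt [:: e] isT.
  by under eq_fun do rewrite big_seq1.
apply/funext => x; rewrite mulr_suml; apply: eq_bigr => e _.
by rewrite mulrBl mulrA.
Qed.

Lemma config_averageable_boltzmann : I (fun x : config R n => expR (hamiltonian beta h x)).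
Proof.
have [C HC] := @hamiltonian_bounded R n beta h (- B) B.
apply: (config_averageable_bounded muB (M := expR C)).
  by apply: measurableT_comp => //; exact: measurable_hamiltonian.
move=> x xB; rewrite ger0_norm ?expR_ge0// ler_expR HC// => e.
by rewrite in_itv/= -ler_norml.
Qed.

(* Jensen's inequality (Gibbs' variational principle) for the product of tilted
   laws; the three edges of a star are distinct, so under it the energy has the
   mean that it takes at the constant configuration. *)
Lemma partition_lower :
  expR (hamiltonian beta h (const_config c) - N * (t * c - L t)) <=
  E (fun x : config R n => expR (hamiltonian beta h x)).
Proof.
set a := _ - _.
pose S (x : config R n) := \sum_(e : edge n) (t * weight x e - L t).
(* Tangent line of the exponential: [1 + y <= expR y] at [y = H - S - a], multiplied by
   [expR a * W]. As [a] is the tilted mean of [H - S], the left side averages to [expR a]. *)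
have [intg Eg] : has_average (fun x => expR a *
    ((hamiltonian beta h x * W x - S x * W x) + (1 - a) * W x)) (expR a).
  rewrite -[X in has_average _ X]mulr1; apply: has_averageZ.
  rewrite [X in has_average _ X](_ : 1 = (hamiltonian beta h (const_config c) -
    N * (t * c - L t)) + (1 - a) * 1); last by rewrite mulr1 addrC subrK.
  apply: has_averageD; last by apply: has_averageZ; exact: has_average_tilt.
  by apply: has_averageB; [exact: has_average_hamiltonian|exact: has_average_log_tilt].
rewrite -[leLHS]Eg; apply: (le_config_average muB) => //.
  exact: config_averageable_boltzmann.
move=> x _; rewrite -mulrBl -mulrDl.
have -> : expR (hamiltonian beta h x) =
    expR a * (expR (hamiltonian beta h x - S x - a) * W x).
  by rewrite /config_tilt -/(S x) -!expRD; congr expR; ring.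
rewrite ler_pM2l ?expR_gt0// ler_pM2r; last exact: expR_gt0.
by rewrite (le_trans _ (expR_ge1Dx _))//; lra.
Qed.

End partition_function_bounds.

Lemma edge_three_star_upper (R : realType) (n : nat)
    (mu : probability (measurableTypeR R) R) (B : R)
    (muB : mu `[- B, B]%classic = 1%E) (beta h : R)
    (S : set (config R n)) (g : config R n -> R) :
  measurable S -> config_averageable mu g -> (forall x, 0 <= g x) ->
  (forall x, S x -> weight_box B x -> expR (hamiltonian beta h x) <= g x) ->
  (edge_three_star mu beta h S <=
    (config_average mu g /
     config_average mu (fun x : config R n => expR (hamiltonian beta h x)))%:E)%E.
Proof.
move=> mS intg g0 Sg; rewrite /edge_three_star.
have -> : fine (partition_function n mu beta h) =
    config_average mu (fun x : config R n => expR (hamiltonian beta h x)).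
  by rewrite config_average.unlock.
set Z := config_average mu _.
(* The Jensen bound at tilt 0 already gives positivity. *)
have Z0 : 0 < Z by rewrite (lt_le_trans _ (partition_lower n muB beta h 0))// expR_gt0.
pose f (x : config R n) := Z^-1 * expR (hamiltonian beta h x).
have intf : config_averageable mu f.
  by apply: config_averageableZ; exact: config_averageable_boltzmann muB _ _.
have intfS : config_averageable mu (f \_ S).
  have := (integrable_mkcond _ mS).1 (integrableS measurableT mS (@subsetT _ _) intf).
  by rewrite /config_averageable restrict_EFin.
have -> : (\int[product_power mu #|edge n|]_(x in S) (expR (hamiltonian beta h x) / Z)%:E)%E
   = (config_average mu (f \_ S))%:E.
  rewrite config_average.unlock /Rintegral fineK; last exact: integrable_fin_num.
  rewrite [LHS]integral_mkcond.
  apply: eq_integral => x _.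
  by rewrite !patchE /f; case: ifP => // _; rewrite mulrC.
rewrite lee_fin mulrC -config_averageZ//; apply: (le_config_average muB) => //.
  exact: config_averageableZ.
move=> x xB; rewrite patchE; case: ifPn => [|_].
  by rewrite inE => Sx; rewrite /f ler_pM2l ?invr_gt0//; exact: Sg.
by rewrite mulr_ge0// invr_ge0 ltW.
Qed.

(** * Exponential bound *)

Lemma natr_bin2 (R : realType) (n : nat) : (0 < n)%N ->
  'C(n, 2)%:R = n%:R * (n%:R - 1) / 2 :> R.
Proof.
case: n => // n _; have := mul_bin_diag n.+1 1; rewrite bin1 /=.
move=> /(congr1 (fun k => k%:R : R)); rewrite !natrM -[n.+1%:R]natr1.
by move: ('C(_, _)%:R) n%:R => a b; lra.
Qed.

Lemma measurable_field_variance (R : realType) (n : nat) :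
  measurable_fun setT (@field_variance R n).
Proof.
have mw e : measurable_fun setT (fun x : config R n => weight x e).
  exact: measurable_tnth.
have ml e : measurable_fun setT (fun x : config R n => local_field x e).
  apply: measurable_sum => e1; apply: measurable_sum => e2.
  by apply: measurable_funM => //; apply: measurable_funM.
have mm : measurable_fun setT (@mean_field R n).
  by apply: measurable_funM => //; exact: measurable_sum.
apply: measurable_funM => //; apply: measurable_sum => e.
by apply: measurable_funX; apply: measurable_funB.
Qed.

Lemma degree_const_config (R : realType) (n : nat) (a : R) (i : 'I_n) :
  degree (const_config n a) i = n%:R * a - a.
Proof.
have W j : weight_mx (const_config n a) i j = a - (i == j)%:R * a.
  have [<-|ij] := eqVneq i j; first by rewrite weight_mx_diag mul1r subrr.
  have ije : #|[set i; j]%SET| == 2 by rewrite cards2 ij.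
  by rewrite (weight_mx_pair _ ije) weight_const_config mul0r subr0.
rewrite /degree; under eq_bigr do rewrite W.
by rewrite sumrB sumr_const card_ord -mulr_suml sum_indic_eq mul1r mulr_natl.
Qed.

Section exponential_bound.
Context (R : realType) (mu : probability (measurableTypeR R) R).
Context (B : R) (B0 : 0 < B) (muB : mu `[- B, B]%classic = 1%E).
Context (beta h : R).
Local Notation c := (tilted_mean mu).
Local Notation L := (log_mgf mu).
Local Notation lip := (energy_lipschitz B beta h).
Local Notation K := (lip + 1).
Local Notation Z n :=
  (config_average mu (fun x : config R n => expR (hamiltonian beta h x))).

(** Energy minus entropy: [t * c t - L t] is the relative entropy of the tilted law with respect to
    [mu]. *)
Definition mean_field_value (t : R) : R :=
  local_energy beta h (c t) - t * c t + L t.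

(** The three parts of the linear error come from [hamiltonian_approx], from the constant
    configuration having normalized degree [c t - c t / n], and from [n * (n - 1) / 2] edges in
    place of [n^2 / 2]. *)
Lemma partition_lower_mean_field (n : nat) (t : R) : (0 < n)%N -> `|t| <= K ->
  expR (n%:R ^+ 2 / 2 * mean_field_value t
    - (`|beta| * B ^+ 3 + lip * B / 2 + B * K) * n%:R) <= Z n.
Proof.
move=> n0 tK; have B0' := ltW B0.
have np : 0 < n%:R :> R by rewrite ltr0n.
have cB : `|c t| <= B by exact: tilted_mean_bounded.
apply: le_trans (partition_lower n muB beta h t); rewrite ler_expR.
set x := const_config n (c t).
have wB e : `|weight x e| <= B by rewrite weight_const_config.
have := hamiltonian_approx wB B0' beta h n0; rewrite ler_norml => /andP[+ _].
have S : n%:R / 2 * \sum_(i < n) (local_energy beta h (c t) - lip * (B / n%:R)) <=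
    n%:R / 2 * \sum_(i < n) local_energy beta h (degree x i / n%:R).
  rewrite ler_wpM2l ?divr_ge0//; apply: ler_sum => i _.
  have dB : `|degree x i / n%:R| <= B.
    rewrite normrM normfV [`|n%:R|]ger0_norm// ler_pdivrMr// mulrC.
    exact: degree_le.
  have := local_energy_lipschitz B0' beta h cB dB.
  have -> : c t - degree x i / n%:R = c t / n%:R.
    by rewrite degree_const_config; field; rewrite gt_eqF.
  rewrite normrM normfV [`|n%:R|]ger0_norm// => H.
  have : lip * (`|c t| / n%:R) <= lip * (B / n%:R).
    by rewrite ler_wpM2l ?energy_lipschitz_ge0// ler_pM2r ?invr_gt0.
  move: H; rewrite ler_norml => /andP[_]; move: (local_energy _ _ _) (local_energy _ _ _).
  by move: (_ * (_ / _)) (_ * (_ / _)) => *; lra.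
move: S; rewrite sumr_const card_ord -[(_ - _) *+ n]mulr_natl.
have -> : n%:R / 2 * (n%:R * (local_energy beta h (c t) - lip * (B / n%:R))) =
    n%:R ^+ 2 / 2 * local_energy beta h (c t) - lip * B / 2 * n%:R.
  by move: (local_energy _ _ _) (energy_lipschitz _ _ _) => p q; field; rewrite gt_eqF.
rewrite card_edge natr_bin2//.
have tc : - (t * c t - L t) <= 2 * (B * K).
  have h1 : - (t * c t) <= B * K.
    by rewrite (le_trans (ler_norm _))// normrN normrM mulrC ler_pM.
  have h2 : L t <= B * K.
    by rewrite (le_trans (ler_norm _))// (le_trans (log_mgf_bounded muB t))// ler_wpM2l.
  by move: (t * _) (L t) (B * K) h1 h2 => *; lra.
have tc' : - (n%:R / 2 * (t * c t - L t)) <= B * K * n%:R.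
  rewrite -mulrN (le_trans (ler_wpM2l _ tc)) ?divr_ge0//.
  by rewrite le_eqVlt; apply/orP; left; apply/eqP; field.
rewrite /mean_field_value.
have -> : n%:R * (n%:R - 1) / 2 * (t * c t - L t) =
    n%:R ^+ 2 / 2 * (t * c t - L t) - n%:R / 2 * (t * c t - L t).
  by move: (t * _ - _) => p; field.
have -> : n%:R ^+ 2 / 2 * (local_energy beta h (c t) - t * c t + L t) =
    n%:R ^+ 2 / 2 * local_energy beta h (c t) - n%:R ^+ 2 / 2 * (t * c t - L t).
  by move: (local_energy _ _ _) (t * _) (L t) => p q r; ring.
rewrite ![(_ + _) * n%:R]mulrDl; move: tc'.
move: (n%:R / 2 * (_ - _)) (n%:R ^+ 2 / 2 * (_ - _)) (n%:R / 2 * \sum_i _).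
move: (n%:R ^+ 2 / 2 * local_energy _ _ _) (`|beta| * _ * _) (lip * B / 2 * _).
move: (B * _ * _) (hamiltonian _ _ _) => *; lra.
Qed.

Definition dispersion_cost : R := 24 * B + 48 * B ^+ 2.

Lemma dispersion_cost_gt0 : 0 < dispersion_cost.
Proof. by rewrite addr_gt0// mulr_gt0// exprn_gt0. Qed.

(** [field_variance_le] solved for the dispersion, with at least [n^2 / 4] edges and an
    approximation error of at most [54 * B ^+ 4]. *)
Lemma dispersion_lower (n : nat) (x : config R n) (eps : R) : (1 < n)%N ->
  (forall e, `|weight x e| <= B) -> 0 < eps -> eps < field_variance x ->
  eps / (48 * B ^+ 2) * n%:R ^+ 2 - 9 / 2 * B ^+ 2 <= dispersion x.
Proof.
move=> n1 xB eps0 epsT; have n0 := ltnW n1.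
have np : 0 < n%:R :> R by rewrite ltr0n.
have n2 : 2 <= n%:R :> R by rewrite ler_nat.
have B2 : 0 < B ^+ 2 by rewrite exprn_gt0.
have := field_variance_le xB (ltW B0) n1; rewrite -/(dispersion x) natr_bin2//.
have h1 : n%:R ^+ 2 / 4 * eps <= n%:R * (n%:R - 1) / 2 * field_variance x.
  apply: ler_pM; [by rewrite divr_ge0 ?sqr_ge0|exact: ltW| |exact: ltW].
  have : 0 <= n%:R * (n%:R - 2) :> R by rewrite mulr_ge0 ?subr_ge0// ltW.
  by move: n%:R => m; lra.
have h2 : 3 * (n%:R * (n%:R - 1) / 2) * (6 * B ^+ 2 / n%:R) ^+ 2 <= 54 * B ^+ 4.
  have -> : 3 * (n%:R * (n%:R - 1) / 2) * (6 * B ^+ 2 / n%:R) ^+ 2 =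
      54 * B ^+ 4 - 54 * B ^+ 4 / n%:R by field; rewrite gt_eqF.
  by rewrite lerBlDr lerDl divr_ge0 ?mulr_ge0 ?exprn_ge0// ltW.
move=> h3.
have : n%:R ^+ 2 / 4 * eps - 54 * B ^+ 4 <= 12 * B ^+ 2 * dispersion x.
  by move: h1 h2 h3; move: (12 * _ * _) (_ * field_variance x) (3 * _ * _) => *; lra.
rewrite [leRHS]mulrC -ler_pdivrMr ?mulr_gt0//; apply: le_trans.
by rewrite le_eqVlt; apply/orP; left; apply/eqP; field; rewrite gt_eqF.
Qed.

Lemma edge_three_star_exponential_bound (eps : R) : 0 < eps ->
  exists a C : R, 0 < a /\ forall n, (1 < n)%N ->
    (edge_three_star mu beta h [set x : config R n | (eps < `|field_variance x|)%R]
      <= (expR (C * n%:R - a * n%:R ^+ 2))%:E)%E.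
Proof.
move=> eps0; have B0' := ltW B0; have D0 := dispersion_cost_gt0.
have K0 : 0 < K by rewrite ltr_wpDl// energy_lipschitz_ge0.
have B2 : 0 < B ^+ 2 by rewrite exprn_gt0.
set D := dispersion_cost in D0.
pose q := eps / (48 * B ^+ 2); have q0 : 0 < q by rewrite divr_gt0// mulr_gt0.
(* The dispersion gains [q / D * n^2] in the exponent; this [eta] makes the net error
   [K * eta * n^2] exactly half of the gain. *)
pose eta := q / (2 * D * K); have eta0 : 0 < eta by rewrite divr_gt0// !mulr_gt0.
have [m [t [tK net]]] := local_energy_net B0' muB beta h eta0.
have [k0 tk0] : exists k0, forall k, mean_field_value (t k) <= mean_field_value (t k0).
  exists [arg max_(k > ord0) mean_field_value (t k)]%O => k.
  by case: arg_maxP => // i _; exact.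
set M := mean_field_value (t k0).
pose C1 := `|beta| * B ^+ 3 + B * K / 2.
pose C2 := `|beta| * B ^+ 3 + lip * B / 2 + B * K.
pose b := 9 / 2 * B ^+ 2 / D.
exists (q / (2 * D)), (ln m.+1%:R + C1 + C2 + b); split.
  by rewrite divr_gt0// mulr_gt0.
move=> n n1; have n0 := ltnW n1.
have np : 0 < n%:R :> R by rewrite ltr0n.
have n1' : 1 <= n%:R :> R by rewrite ler1n.
pose A := n%:R ^+ 2 / 2 * M - q / (2 * D) * n%:R ^+ 2 + (C1 + b) * n%:R.
pose W (tau : {ffun 'I_n -> 'I_m.+1}) (x : config R n) :=
  config_tilt mu (edge_tilt (t \o tau)) x.
(* The tilt vector depends on the configuration, so all of them are summed: [m.+1 ^ n] densities of
   mass one, a factor [expR (n * ln m.+1)]. *)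
pose g (x : config R n) := expR A * \sum_tau W tau x.
have intW tau : config_averageable mu (W tau) by exact: config_averageable_tilt muB _.
have intg : config_averageable mu g.
  by apply: config_averageableZ; exact: config_averageable_sum.
have W0 tau x : 0 <= W tau x by exact: expR_ge0.
have Eg : config_average mu g = expR A * m.+1%:R ^+ n.
  rewrite config_averageZ; last exact: config_averageable_sum.
  rewrite config_average_sum//; congr (_ * _).
  under eq_bigr do rewrite (config_average_tilt muB).
  by rewrite sumr_const card_ffun !card_ord natrX.
apply: (le_trans (edge_three_star_upper muB _ intg _ _)).
- rewrite -[X in measurable X]setTI.
  apply: (measurable_fun_ltr (measurable_cst _)) => //.
  by apply: measurableT_comp => //; exact: measurable_field_variance.
- by move=> x; rewrite mulr_ge0 ?expR_ge0// sumr_ge0.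
- move=> x; rewrite /= ger0_norm; last first.
    by rewrite mulr_ge0 ?invr_ge0// sumr_ge0// => e _; exact: sqr_ge0.
  move=> epsT xB.
  have dB i : `|degree x i / n%:R| <= B.
    rewrite normrM normfV [`|n%:R|]ger0_norm// ler_pdivrMr// mulrC.
    exact: degree_le.
  have /fin_all_exists [f Hf] := fun i => net _ (dB i).
  pose tau := [ffun i => f i].
  apply: (@le_trans _ _ (expR A * W tau x)); last first.
    by rewrite ler_pM2l ?expR_gt0// (bigD1 tau)//= lerDl sumr_ge0.
  rewrite -expRD ler_expR.
  have energy_le i : local_energy beta h (degree x i / n%:R) <=
      M + t (tau i) * (degree x i / n%:R) - L (t (tau i))
      - `|degree x i / n%:R - c (t (tau i))| + 2 * K * eta.
    rewrite ffunE; apply: (le_trans (Hf i)); have := tk0 (f i).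
    rewrite -/M /mean_field_value mulrBr.
    move: (local_energy _ _ _) (t _ * _) (t _ * _) (L _) `|_| (2 * _ * _) => *; lra.
  apply: (le_trans (hamiltonian_upper B0 muB n0 xB (fun i => tK (tau i)) energy_le)).
  have := dispersion_lower n1 xB eps0 epsT; rewrite -/q => disp.
  have {}disp : q / D * n%:R ^+ 2 - b <= dispersion x / D.
    rewrite ler_pdivlMr//; apply: le_trans disp.
    by rewrite le_eqVlt; apply/orP; left; apply/eqP; rewrite /b; field; rewrite gt_eqF.
  (* The additive constant of [dispersion_lower] is absorbed into the linear term. *)
  have bn : b <= b * n%:R by rewrite ler_peMr// divr_ge0 ?mulr_ge0// ltW.
  have -> : n%:R ^+ 2 / 2 * (M + 2 * K * eta) =
      n%:R ^+ 2 / 2 * M + q / (2 * D) * n%:R ^+ 2.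
    by rewrite /eta; field; rewrite !gt_eqF.
  have E2 : q / D * n%:R ^+ 2 = q / (2 * D) * n%:R ^+ 2 + q / (2 * D) * n%:R ^+ 2.
    by field; rewrite gt_eqF.
  move: disp bn; rewrite E2 /A /dispersion_cost -/D -/C1 [(C1 + b) * _]mulrDl.
  move: (q / _ * _) (n%:R ^+ 2 / 2 * M) (dispersion x / _) (b * _) (C1 * _).
  by move: (\sum_e _) => *; lra.
rewrite lee_fin Eg.
(* At the maximizing tilt [t k0] the lower bound has the same leading term [n^2 / 2 * M] as the
   numerator, so only the loss in [n^2] and linear terms remain. *)
have Zge := partition_lower_mean_field n0 (tK k0).
rewrite -/M -/C2 in Zge.
have Z0 : 0 < Z n by apply: lt_le_trans Zge; exact: expR_gt0.
rewrite ler_pdivrMr//.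
have -> : m.+1%:R ^+ n = expR (ln m.+1%:R * n%:R) :> R.
  by rewrite expRM_natr lnK// posrE ltr0n.
apply: le_trans (ler_wpM2l (expR_ge0 _) Zge).
rewrite -!expRD ler_expR /A le_eqVlt; apply/orP; left; apply/eqP.
ring.
Qed.

End exponential_bound.

(** * Convergence in probability *)

Unset Implicit Arguments.

Theorem theorem2p3 (R : realType) (kminus kplus : R)
    (mu : probability (measurableTypeR R) R) :
  kminus < kplus ->
  mu `[kminus, kplus]%classic = 1%E ->
  measure_support mu kminus ->
  measure_support mu kplus ->
  forall (beta0 h0 : R) (eps : R), 0 < eps ->
    edge_three_star mu beta0 h0
      [set x : config R n | eps < `|field_variance x| ]
      @[n --> \oo] --> 0%E.
Proof.
move=> kk muk _ _ beta h eps eps0.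
pose B := Num.max `|kminus| `|kplus|.
have kmB : `|kminus| <= B by rewrite le_max lexx.
have kpB : `|kplus| <= B by rewrite le_max lexx orbT.
have B0 : 0 < B.
  rewrite lt_neqAle le_max normr_ge0 andbT; apply/eqP => B0.
  move: kmB kpB kk; rewrite -B0 !normr_le0 => /eqP -> /eqP ->.
  by rewrite ltxx.
have mI (a b : R) : measurable (`[a, b]%classic : set (measurableTypeR R)).
  exact: measurable_itv.
have muB : mu `[- B, B]%classic = 1%E.
  apply/eqP; rewrite eq_le probability_le1//= -[leLHS]muk.
  apply: le_measure; rewrite ?inE//; try exact: mI.
  apply: subitvP; rewrite subitvE !bnd_simp.
  move: kmB kpB; rewrite !ler_norml => /andP[-> _] /andP[_ ->] //.
have [a [C [a0 bound]]] := edge_three_star_exponential_bound B0 muB beta h eps0.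
(* Once [a * n >= C + 1], the exponent [C * n - a * n^2] is at most [- n]. *)
apply: (squeeze_cvge (f := fun=> 0%E) (h := fun n => (expR (- n%:R))%:E)).
- near=> n; apply/andP; split.
    apply: integral_ge0 => x _; rewrite lee_fin divr_ge0 ?expR_ge0//.
    apply: fine_ge0; apply: integral_ge0 => y _.
    by rewrite lee_fin expR_ge0.
  apply: le_trans (bound n _) _; first by near: n; exact: nbhs_infty_gt.
  rewrite lee_fin ler_expR.
  have Cn : (C + 1) / a <= n%:R by near: n; exact: nbhs_infty_ger.
  rewrite -subr_ge0; have -> : - n%:R - (C * n%:R - a * n%:R ^+ 2) =
    (a * n%:R - (C + 1)) * n%:R by ring.
  by rewrite mulr_ge0// subr_ge0 mulrC -ler_pdivrMr.
- exact: cvg_cst.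
- by apply: cvg_EFin; [exact: nearW|exact: cvgn_expR].
Unshelve. all: by end_near.
Qed.
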